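(* Let $p$ be an odd prime, let $K=\mathbb Q_p$ with algebraic closure $\overline{\mathbb Q_p}$, and let $f(X)=X^{2p}$. Then there exists a sequence $(t_n)_{n\geq 0}$ in $\overline{\mathbb Q_p}$ with $t_0=1+p$ and $f(t_{n+1})=t_n$ for all $n\geq 0$ such that the extension $K_\infty=\bigcup_{n\geq 0}\mathbb Q_p(t_n)$ of $\mathbb Q_p$ is deeply ramified but not arithmetically profinite (APF).
   Context: Let $v_p$ be the valuation on $\overline{\mathbb Q_p}$ with $v_p(p)=1$, and let $\mathfrak D_{F/K}$ denote the different of a finite extension $F/K$, whose valuation is that of any generator. Deep ramification is the notion of Coates and Greenberg, used through the standard criterion: an algebraic extension $L/K$ is deeply ramified if and only if the valuations $v_p(\mathfrak D_{F/K})$, with $F$ ranging over the finite subextensions of $L/K$ (equivalently, over any cofinal tower of finite subextensions), are unbounded. An algebraic extension $L/K$ is arithmetically profinite (APF) in the sense of Fontaine--Wintenberger if for every real $u\geq -1$ the subgroup $G_K^u G_L$ is open in $G_K$, where $G_K=\operatorname{Gal}(\overline K/K)$, $G_L=\operatorname{Gal}(\overline K/L)$ and $G_K^u$ are the upper-numbering ramification subgroups of $G_K$. A standard necessary condition for $L/K$ to be APF is that the maximal unramified subextension of $L/K$ is finite over $K$. *)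

(* Defs.v *)
From HB Require Import structures.
From mathcomp Require Import all_boot all_order all_algebra all_fingroup all_field.
From mathcomp Require Import all_classical all_reals all_analysis.

Set Implicit Arguments.
Unset Strict Implicit.
Unset Printing Implicit Defensive.
Import Order.TTheory GRing.Theory Num.Theory.
Local Open Scope classical_set_scope.
Local Open Scope ring_scope.

(* Real-valued additive valuations; the value at 0 is +oo. *)
Definition is_valuation (R : realType) (E : fieldType) (v : E -> \bar R) : Prop :=
  [/\ v 0 = +oo%E,
      forall x, x != 0 -> v x \is a fin_num,
      forall x y, v (x * y) = (v x + v y)%E
    & forall x y, (Order.min (v x) (v y) <= v (x + y)%R)%E].

Definition val_cauchy (R : realType) (E : fieldType) (v : E -> \bar R)
    (u : nat -> E) : Prop :=
  forall m : nat, exists N : nat, forall i k : nat,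
    (N <= i)%N -> (N <= k)%N -> (m%:R%:E <= v (u i - u k)%R)%E.

Definition val_converges (R : realType) (E : fieldType) (v : E -> \bar R)
    (u : nat -> E) (l : E) : Prop :=
  forall m : nat, exists N : nat, forall i : nat,
    (N <= i)%N -> (m%:R%:E <= v (u i - l)%R)%E.

(* (E, v) is Q_p with its p-adic valuation, i.e. the completion of Q at p; this
   determines (E, v) up to a unique isomorphism.  Since v p = 1, v restricts to
   the p-adic valuation on the prime field, and E has characteristic 0, so ratr
   is the embedding of Q. *)
Definition is_padic_field (R : realType) (p : nat) (E : fieldType)
    (v : E -> \bar R) : Prop :=
  [/\ is_valuation v,
      v p%:R = 1%E,
      forall (x : E) (m : nat), exists q : rat, (m%:R%:E <= v (x - ratr q)%R)%E
    & forall u : nat -> E, val_cauchy v u -> exists l : E, val_converges v u l].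

Definition is_algebraic_closure (K : fieldType) (L : closedFieldType)
    (iota : {rmorphism K -> L}) : Prop :=
  forall x : L, algebraicOver iota x.

(* Throughout, L is an algebraic closure of K via iota, w is a valuation on L, and
   K carries the valuation w \o iota.  A finite extension of K inside L is
   given by F : fieldExtType K together with a K-embedding j of F into L. *)
Definition is_Kembedding (K L : fieldType) (iota : {rmorphism K -> L})
    (F : fieldExtType K) (j : {rmorphism F -> L}) : Prop :=
  forall a : K, j (a%:A) = iota a.

Definition is_subfield (L : fieldType) (S : set L) : Prop :=
  [/\ S 1, forall x y, S x -> S y -> S (x - y)
    & forall x y, S x -> S y -> S (x / y)].

Definition adjoin (K L : fieldType) (iota : {rmorphism K -> L}) (t : L) : set L :=
  smallest (@is_subfield L) (range iota `|` [set t]).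

Definition field_trace (K : fieldType) (F : fieldExtType K) (x : F) : K :=
  \tr (passmx.mxof (vbasis {:F}) (vbasis {:F}) (amulr x)).

Definition val_ring (R : realType) (L : fieldType) (w : L -> \bar R)
    (E : fieldType) (j : {rmorphism E -> L}) : set E :=
  [set x | (0 <= w (j x))%E].

Definition codifferent (R : realType) (K L : fieldType) (w : L -> \bar R)
    (iota : {rmorphism K -> L}) (F : fieldExtType K) (j : {rmorphism F -> L})
    : set F :=
  [set x | forall y, val_ring w j y -> val_ring w iota (field_trace (x * y))].

Definition different (R : realType) (K L : fieldType) (w : L -> \bar R)
    (iota : {rmorphism K -> L}) (F : fieldExtType K) (j : {rmorphism F -> L})
    : set F :=
  [set x | forall y, codifferent w iota j y -> val_ring w j (x * y)].

Definition different_generator (R : realType) (K L : fieldType)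
    (w : L -> \bar R) (iota : {rmorphism K -> L})
    (F : fieldExtType K) (j : {rmorphism F -> L}) (d : F) : Prop :=
  different w iota j = [set d * y | y in val_ring w j].

(* Deep ramification of M / K in the sense of Coates and Greenberg, in the form
   of unboundedness of the valuations of the differents. *)
Definition deeply_ramified (R : realType) (K L : fieldType) (w : L -> \bar R)
    (iota : {rmorphism K -> L}) (M : set L) : Prop :=
  forall B : R,
    exists (F : fieldExtType K) (j : {rmorphism F -> L}) (d : F),
      [/\ is_Kembedding iota j, range j `<=` M,
          different_generator w iota j d & (B%:E <= w (j d))%E].

Definition abs_galois (K L : fieldType) (iota : {rmorphism K -> L})
    : set (L -> L) :=
  [set s | [/\ zmod_morphism s, GRing.monoid_morphism s, bijective s
             & forall a, s (iota a) = iota a]].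

Definition abs_galois_fixing (K L : fieldType) (iota : {rmorphism K -> L})
    (M : set L) : set (L -> L) :=
  [set s | abs_galois iota s /\ forall x, M x -> s x = x].

(* Openness for the Krull topology of the absolute Galois group. *)
Definition krull_open (K L : fieldType) (iota : {rmorphism K -> L})
    (H : set (L -> L)) : Prop :=
  H `<=` abs_galois iota /\
  forall s, H s ->
    exists (F : fieldExtType K) (j : {rmorphism F -> L}),
      is_Kembedding iota j /\
      forall s', abs_galois iota s' -> (forall x : F, s' (j x) = s (j x)) -> H s'.

(* e is the factor for which e * w is the valuation of F with value group Z. *)
Definition normalizing_factor (R : realType) (L : fieldType) (w : L -> \bar R)
    (E : fieldType) (j : {rmorphism E -> L}) (e : nat) : Prop :=
  (0 < e)%N /\
  [set (e%:R%:E * w (j x))%E | x in [set x : E | x != 0]] =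
  [set (k%:~R : R)%:E | k in [set: int]].

(* G_t for real t >= -1; e is the normalizing factor of F.  As e * w is
   integer-valued on nonzero elements of F, this is G_i with i the ceiling of t. *)
Definition lower_ramification (R : realType) (K L : fieldType) (w : L -> \bar R)
    (F : splittingFieldType K) (j : {rmorphism F -> L}) (e : nat) (t : R)
    : {set gal_of {:F}} :=
  [set g in 'Gal({:F} / 1)%g |
    `[< forall x : F, val_ring w j x ->
          ((t + 1)%:E <= e%:R%:E * w (j (g x - x)%R))%E >]]%SET.

(* Herbrand's function phi; the usual convention on the indices (G_0 : G_x) for
   -1 <= x <= 0 makes it the identity on [-1, 0]. *)
Definition herbrand (R : realType) (K L : fieldType) (w : L -> \bar R)
    (F : splittingFieldType K) (j : {rmorphism F -> L}) (e : nat) (t : R) : R :=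
  if t <= 0 then t
  else (\int[lebesgue_measure]_(x in `[0%R, t])
     (#|lower_ramification w j e x|%:R / #|lower_ramification w j e 0|%:R : R))%R.

(* Gal(F/K)^u = Gal(F/K)_t where phi t = u. *)
Definition upper_ramification (R : realType) (K L : fieldType) (w : L -> \bar R)
    (F : splittingFieldType K) (j : {rmorphism F -> L}) (u : R)
    : set (gal_of {:F}) :=
  [set g | exists (e : nat) (t : R),
     [/\ normalizing_factor w j e, -1 <= t, herbrand w j e t = u
       & g \in lower_ramification w j e t]].

(* G_K^u is the inverse limit of the Gal(F/K)^u over finite Galois F/K. *)
Definition abs_upper_ramification (R : realType) (K L : fieldType)
    (w : L -> \bar R) (iota : {rmorphism K -> L}) (u : R) : set (L -> L) :=
  [set s | abs_galois iota s /\
     forall (F : splittingFieldType K) (j : {rmorphism F -> L}),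
       is_Kembedding iota j -> galois 1 {:F} ->
       exists2 g : gal_of {:F}, upper_ramification w j u g
         & forall x : F, j (g x) = s (j x)].

Definition arithmetically_profinite (R : realType) (K L : fieldType)
    (w : L -> \bar R) (iota : {rmorphism K -> L}) (M : set L) : Prop :=
  forall u : R, -1 <= u ->
    krull_open iota
      [set a \o b | a in abs_upper_ramification w iota u
                  & b in abs_galois_fixing iota M].

(* Main.v *)
Require Import Defs.
From HB Require Import structures.
From mathcomp Require Import all_boot all_order all_algebra all_fingroup all_field.
From mathcomp Require Import all_classical all_reals all_analysis.
From mathcomp Require Import ring zify.

Set Implicit Arguments.
Unset Strict Implicit.
Unset Printing Implicit Defensive.
Import Order.TTheory GRing.Theory Num.Theory.
Local Open Scope classical_set_scope.
Local Open Scope ring_scope.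

(* The roots t_n of f^n(X) = 1 + p are chosen so that t_n^(p^n) = zeta_n s_n with
   s_n in Z_p the principal unit satisfying s_n^(2^n) = 1 + p and zeta_n a
   primitive 2^n-th root of unity; thus zeta_n lies in Q_p(t_n).

   Deep ramification: u = t_n^(2^n) satisfies u^N = 1 + p with N = p^n, and u - 1
   has valuation 1/N.  Hence Q_p(u) has ring of integers Z_p[u - 1] = Z_p[u], and
   as u^i has trace 0 for 0 < i < N, the different of Q_p(u) is generated by N,
   of valuation n.

   Failure of APF: G^0 and G_(K_oo) both fix every root of unity of 2-power order.
   If G^0 G_(K_oo) contained all automorphisms fixing some finite F, then F would
   contain all these roots of unity; but a finite extension of degree d contains
   no primitive 2^m-th root of unity when 2^m > p^d.  Indeed an integral relation
   of degree <= d satisfied by zeta modulo the maximal ideal is also satisfied by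
   its Frobenius conjugates zeta^(p^k), 0 <= k <= d, which are distinct modulo
   the maximal ideal. *)

(** * Valuations *)

Section Valuation.
Variables (R : realType) (E : fieldType) (v : E -> \bar R).
Hypothesis v_val : is_valuation v.

Lemma val0 : v 0 = +oo%E. Proof. by case: v_val. Qed.

Lemma val_fin x : x != 0 -> v x \is a fin_num.
Proof. by case: v_val => _ + _ _; exact. Qed.

Lemma valM x y : v (x * y) = (v x + v y)%E. Proof. by case: v_val. Qed.

Lemma val_finE x : x != 0 -> v x = (fine (v x))%:E.
Proof. by move=> x0; rewrite fineK // val_fin. Qed.

Lemma val1 : v 1 = 0%E.
Proof.
have := valM 1 1; rewrite mulr1 (val_finE (oner_neq0 _)) -EFinD => -[/eqP].
by rewrite -subr_eq0 opprD addrA subrr sub0r oppr_eq0 => /eqP->.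
Qed.

Lemma valN1 : v (-1) = 0%E.
Proof.
have := valM (-1) (-1); rewrite mulrNN mulr1 val1.
have h : (-1 : E) != 0 by rewrite oppr_eq0 oner_neq0.
rewrite (val_finE h) -EFinD => -[/esym/eqP].
by rewrite -mulr2n mulrn_eq0 /= => /eqP->.
Qed.

Lemma valN x : v (- x) = v x.
Proof. by rewrite -mulN1r valM valN1 add0e. Qed.

Lemma valBC x y : v (x - y) = v (y - x).
Proof. by rewrite -valN opprB. Qed.

Lemma val_geD c x y : (c <= v x -> c <= v y -> c <= v (x + y)%R)%E.
Proof.
move=> cx cy; case: v_val => _ _ _ /(_ x y); apply: le_trans.
by rewrite le_min cx.
Qed.

Lemma val_geB c x y : (c <= v x -> c <= v y -> c <= v (x - y)%R)%E.
Proof. by move=> cx cy; apply: val_geD => //; rewrite valN. Qed.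

Lemma val_gtD c x y : (c < v x -> c < v y -> c < v (x + y)%R)%E.
Proof.
move=> cx cy; case: v_val => _ _ _ /(_ x y); apply: lt_le_trans.
by rewrite lt_min cx.
Qed.

Lemma val_ge_sum (I : Type) (r : seq I) (P : pred I) (F : I -> E) c :
  (forall i, P i -> (c <= v (F i))%E) ->
  (c <= v (\sum_(i <- r | P i) F i))%E.
Proof.
move=> h; elim/big_rec: _ => [|i x Pi]; first by rewrite val0 leey.
by apply: val_geD; exact: h.
Qed.

Lemma val_gt_sum (I : Type) (r : seq I) (P : pred I) (F : I -> E) (c : R) :
  (forall i, P i -> (c%:E < v (F i))%E) ->
  (c%:E < v (\sum_(i <- r | P i) F i))%E.
Proof.
move=> h; elim/big_rec: _ => [|i x Pi]; first by rewrite val0 ltry.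
by apply: val_gtD; exact: h.
Qed.

(** If [x + y] had larger valuation than [x], so would [x = (x + y) - y]. *)
Lemma valD_lt x y : (v x < v y -> v (x + y)%R = v x)%E.
Proof.
move=> xy; apply/le_anti/andP; split; last by apply: val_geD => //; exact: ltW.
rewrite leNgt; apply/negP => h.
have : (v x < v (x + y - y))%E by apply: val_gtD => //; rewrite valN.
by rewrite addrK ltxx.
Qed.

Lemma valX x n : v (x ^+ n) = (n%:R%:E * v x)%E.
Proof.
have [->|x0] := eqVneq x 0.
  case: n => [|n]; first by rewrite expr0 val1 mul0e.
  by rewrite expr0n /= val0 gt0_muley // lte_fin.
have fx := val_finE x0.
elim: n => [|n IH]; first by rewrite expr0 val1 mul0e.
by rewrite exprS valM IH fx -!EFinM -EFinD -[n.+1]add1n natrD mulrDl mul1r.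
Qed.

Lemma valV x : x != 0 -> v x^-1 = (- v x)%E.
Proof.
move=> x0; have := valM x x^-1; rewrite divff // val1.
have xV0 : x^-1 != 0 by rewrite invr_eq0.
rewrite (val_finE x0) (val_finE xV0) -EFinD -EFinN => -[/esym/eqP].
by rewrite addrC addr_eq0 => /eqP->.
Qed.

Lemma val_div x y : y != 0 -> v (x / y) = (v x - v y)%E.
Proof. by move=> y0; rewrite valM valV. Qed.

Lemma valM_ge0 x y : (0 <= v x -> 0 <= v y -> 0 <= v (x * y)%R)%E.
Proof. by move=> ax bx; rewrite valM adde_ge0. Qed.

Lemma valX_ge0 x n : (0 <= v x -> 0 <= v (x ^+ n))%E.
Proof. by move=> x0; rewrite valX mule_ge0 // lee_fin. Qed.

Lemma val_nat_ge0 n : (0 <= v n%:R)%E.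
Proof.
elim: n => [|n IH]; first by rewrite val0 leey.
by rewrite -add1n natrD val_geD // val1.
Qed.

Lemma val_le0_neq0 x : (v x <= 0)%E -> x != 0.
Proof. by apply: contraTneq => ->; rewrite val0. Qed.

Lemma val_eq0_neq0 x : v x = 0%E -> x != 0.
Proof. by move=> h; apply: val_le0_neq0; rewrite h. Qed.

Lemma valX_eq0 x n : (0 < n)%N -> v (x ^+ n) = 0%E -> v x = 0%E.
Proof.
move=> n0 h; have x0 : x != 0 by move/val_eq0_neq0: h; rewrite expf_eq0 n0.
move: h; rewrite valX (val_finE x0) -EFinM => -[/eqP].
by rewrite mulf_eq0 pnatr_eq0 (gtn_eqF n0) => /eqP->.
Qed.

Lemma val_root1 x n : (0 < n)%N -> x ^+ n = 1 -> v x = 0%E.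
Proof. by move=> n0 xn; apply: (@valX_eq0 _ n) => //; rewrite xn val1. Qed.

(* The minimum of the valuations is attained at one index only, so nothing
   cancels against the term there. *)
Lemma val_sum_distinct (I : finType) (F : I -> E) :
  (forall i k, i != k -> F i != 0 -> F k != 0 -> v (F i) != v (F k)) ->
  forall i, (v (\sum_k F k) <= v (F i))%E.
Proof.
move=> F_distinct i.
have [Fi0|Fi_neq0] := eqVneq (F i) 0; first by rewrite Fi0 val0 leey.
have [k Fk_neq0 Fk_min] : exists2 k, F k != 0
    & forall l, F l != 0 -> (v (F k) <= v (F l))%E.
  pose k := [arg min_(k < i | F k != 0) v (F k)]%O.
  exists k; rewrite /k; by case: Order.TotalTheory.arg_minP.
apply: le_trans (Fk_min _ Fi_neq0).
rewrite (bigD1 k) //= valD_lt // (val_finE Fk_neq0).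
apply: val_gt_sum => l lk; rewrite -(val_finE Fk_neq0).
have [->|Fl0] := eqVneq (F l) 0; first by rewrite val0 ltey_eq val_fin.
by rewrite lt_neqAle Fk_min // andbT F_distinct // eq_sym.
Qed.

End Valuation.

(** [k * 'C(p ^ n, k)] is a multiple of [p ^ n]; if [p] did not divide the binomial, [p ^ n] would
    divide [k], which is too small. *)
Lemma prime_power_dvd_bin p n k :
  prime p -> (0 < k < p ^ n)%N -> (p %| 'C(p ^ n, k))%N.
Proof.
move=> p_prime /andP[k_gt0 k_lt]; apply: contraT; rewrite -prime_coprime // => p_coprime.
have : (p ^ n %| k * 'C(p ^ n, k))%N.
  case: k k_gt0 k_lt {p_coprime} => // k _ _.
  have : (0 < p ^ n)%N by rewrite expn_gt0 prime_gt0.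
  by case: (p ^ n)%N => // m _; rewrite -mul_bin_diag dvdn_mulr.
rewrite Gauss_dvdl; last by rewrite coprimeXl.
by move/(dvdn_leq k_gt0); rewrite leqNgt k_lt.
Qed.

(** * Valuations with [v p = 1]: Frobenius congruences and roots of unity of 2-power order *)

Section ResidueCharacteristic.
Variables (R : realType) (E : fieldType) (v : E -> \bar R) (p : nat).
Hypotheses (v_val : is_valuation v) (p_prime : prime p) (vp1 : v p%:R = 1%E).

Lemma p_neq0 : p%:R != 0 :> E.
Proof. by apply/negP => /eqP h; move: vp1; rewrite h val0. Qed.

Lemma val_pnat_dvd n : (p %| n)%N -> (1 <= v n%:R)%E.
Proof.
move=> /dvdnP[m ->]; rewrite natrM (valM v_val) vp1.
by rewrite -[X in (X <= _)%E]add0e leeD // (val_nat_ge0 v_val).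
Qed.

(** By Bezout [1 = a n - b p], which would have positive valuation if [n] had. *)
Lemma val_coprime n : coprime p n -> v n%:R = 0%E.
Proof.
rewrite coprime_sym => np; have n0 := val_nat_ge0 v_val n.
have n_gt0 : (0 < n)%N.
  by case: (posnP n) np p_prime => // ->; rewrite /coprime gcd0n => /eqP->.
apply/eqP; rewrite eq_le n0 andbT leNgt; apply/negP => vn_gt0.
have [a b ab _] := egcdnP p n_gt0.
have : (0 < v 1)%E; last by rewrite (val1 v_val) ltxx.
have -> : (1 : E) = (a * n)%:R - (b * p)%:R.
  by rewrite ab (eqP np) natrD addrAC subrr add0r.
apply: (val_gtD v_val).
  by apply: lt_le_trans vn_gt0 _; rewrite natrM (valM v_val) leeDr ?(val_nat_ge0 v_val).
rewrite (valN v_val); apply: (@lt_le_trans _ _ 1%E); first by rewrite lte_fin.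
by apply: val_pnat_dvd; rewrite dvdn_mull.
Qed.

Lemma char0_of_val n : (0 < n)%N -> n%:R != 0 :> E.
Proof.
elim/ltn_ind: n => n IH n_gt0.
have [pn|pn] := boolP (p %| n)%N; last first.
  by apply: (val_eq0_neq0 v_val); rewrite val_coprime // prime_coprime.
move/dvdnP: pn n_gt0 IH => [m ->]; rewrite muln_gt0 => /andP[m_gt0 _] IH.
by rewrite natrM mulf_neq0 ?p_neq0 // IH // ltn_Pmulr // prime_gt1.
Qed.

(* Only the middle binomial coefficients remain, and they are divisible by p. *)
Lemma val_frobenius n x y : (0 <= v x -> 0 <= v y ->
  1 + v x + v y <= v ((x + y) ^+ (p ^ n) - x ^+ (p ^ n) - y ^+ (p ^ n))%R)%E.
Proof.
move=> x0 y0; have : (0 < p ^ n)%N by rewrite expn_gt0 prime_gt0.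
have : forall k, (0 < k < p ^ n)%N -> (p %| 'C(p ^ n, k))%N.
  by move=> k; exact: prime_power_dvd_bin.
case: (p ^ n)%N => // N dvd_bin _.
rewrite exprDn big_ord_recr /= subnn expr0 mul1r binn mulr1n [_ - _ - _]addrAC addrK.
rewrite big_ord_recl /= subn0 expr0 mulr1 bin0 mulr1n addrC addrA addNr add0r.
apply: (val_ge_sum v_val) => i _; rewrite /bump /= add1n.
rewrite -mulr_natr mulrC !(valM v_val) -addeA leeD //.
  apply: val_pnat_dvd; apply: dvd_bin; by rewrite /= ltnS ltn_ord.
(* A middle term contains both [x] and [y]; splitting off one factor of each yields [v x + v y]. *)
have -> : (N.+1 - i.+1 = (N - i.+1).+1)%N by rewrite subSS subnSK.
rewrite exprS [y ^+ i.+1]exprS !(valM v_val); apply: leeD.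
  by rewrite -[X in (X <= _)%E]adde0 leeD // (valX_ge0 v_val).
by rewrite -[X in (X <= _)%E]adde0 leeD // (valX_ge0 v_val).
Qed.

Lemma val_frobenius1 n y : (0 <= v y ->
  1 + v y <= v ((1 + y) ^+ (p ^ n) - 1 - y ^+ (p ^ n))%R)%E.
Proof.
have := @val_frobenius n 1 y; rewrite (val1 v_val) expr1n adde0; exact.
Qed.

(** With [t = s ^+ (p ^ k)], the Frobenius congruence gains 1 over [v (t - 1)], and the remaining
    [(t - 1) ^+ p] has valuation at least [p (k + 1) >= k + 2]. *)
Lemma val_principal_unit_pow (s : E) k : (1 <= v (s - 1)%R)%E ->
  (k.+1%:R%:E <= v (s ^+ (p ^ k) - 1)%R)%E.
Proof.
move=> s1; elim: k => [|k IH]; first by rewrite expn0 expr1.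
rewrite expnSr exprM; set t := s ^+ _ in IH *.
have t0 : (0 <= v (t - 1)%R)%E by apply: le_trans IH; rewrite lee_fin.
have := val_frobenius1 1 t0; rewrite expn1 [1 + (t - 1)]addrC subrK => h.
rewrite -[_ - 1](subrK ((t - 1) ^+ p)); apply: (val_geD v_val).
  apply: le_trans h; rewrite -[k.+2]add1n natrD EFinD; exact: leeD.
rewrite (valX v_val); apply: le_trans (lee_wpmul2l _ IH); last by rewrite lee_fin.
rewrite -EFinM lee_fin -natrM ler_nat.
apply: (@leq_trans (2 * k.+1)); first by rewrite mul2n -addnn addnS ltnS leq_addr.
by rewrite leq_mul2r prime_gt1 ?orbT.
Qed.

(** Induction applied to [y ^+ 2] gives [y = 1] or [y = -1]; the latter is excluded because 2 is a
    unit when [p] is odd. *)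
Lemma val_unipotent2 (m : nat) (y : E) : odd p ->
  y ^+ (2 ^ m) = 1 -> (0 < v (y - 1)%R)%E -> y = 1.
Proof.
move=> p_odd; elim: m y => [|m IH] y; first by rewrite expn0 expr1.
rewrite expnS exprM => y1 vy.
have v2 : v 2 = 0%E.
  by apply: (@val_coprime 2); rewrite prime_coprime // dvdn_prime2 //;
     apply: contraTneq p_odd => ->.
have vy1 : (0 <= v (y + 1)%R)%E.
  rewrite -[_ + 1](subrK (1 + 1)); apply: (val_geD v_val).
    by rewrite opprD addrA addrK; exact: ltW.
  exact: (val_nat_ge0 v_val 2).
have : y ^+ 2 = 1.
  apply: IH => //; rewrite subr_sqr_1 (valM v_val).
  by apply: lt_le_trans vy _; rewrite leeDl.
move/eqP; rewrite sqrf_eq1 => /orP[/eqP//|/eqP yN1].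
move: vy; rewrite yN1 -opprD (valN v_val); have -> : 1 + 1 = 2 :> E by [].
by rewrite v2 ltxx.
Qed.

(** Reduction modulo the maximal ideal is injective on these roots of unity: apply the previous
    lemma to [a / b]. *)
Lemma val_sub_roots_of_unity2 (m : nat) (a b : E) : odd p ->
  a ^+ (2 ^ m) = 1 -> b ^+ (2 ^ m) = 1 -> (0 < v (a - b)%R)%E -> a = b.
Proof.
move=> p_odd a1 b1 vab.
have vb : v b = 0%E by apply: (val_root1 v_val) b1; rewrite expn_gt0.
have b_neq0 := val_eq0_neq0 v_val vb.
apply: (divIf b_neq0); rewrite divff //.
apply: (@val_unipotent2 m) => //; first by rewrite expr_div_n a1 b1 divr1.
have -> : a / b - 1 = (a - b) / b by rewrite mulrBl divff.
by rewrite (val_div v_val) // vb sube0.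
Qed.

End ResidueCharacteristic.

(** * Extension of embeddings to automorphisms of the algebraic closure *)

Section SubfieldType.
Variables (F : fieldType) (S : divringClosed F).

(** Makes a subfield a [fieldType] of its own, so that polynomials over it can be formed. *)
Definition subfield_type := {x : F | x \in S}.

HB.instance Definition _ := SubChoice.on subfield_type.
HB.instance Definition _ := [SubChoice_isSubComUnitRing of subfield_type by <:].
HB.instance Definition _ :=
  [SubComUnitRing_isSubIntegralDomain of subfield_type by <:].
HB.instance Definition _ :=
  [SubIntegralDomain_isSubField of subfield_type by <:].

Definition subfield_val : subfield_type -> F := val.

HB.instance Definition _ := GRing.RMorphism.copy subfield_val (val : subfield_type -> F).

End SubfieldType.

Section SimpleExtension.
Variables (K L : fieldType) (iota : {rmorphism K -> L}).

Lemma min_irreducible_poly x : algebraicOver iota x ->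
  exists2 m : {poly K}, irreducible_poly m & root (map_poly iota m) x.
Proof.
case=> q q_neq0 qx.
pose P n := `[< exists m : {poly K}, [/\ m != 0, root (map_poly iota m) x & size m = n] >].
have exP : exists n, P n by exists (size q); apply/asboolP; exists q.
case: (ex_minnP exP) => n /asboolP[m [m_neq0 mx m_size]] n_min.
exists m => //; apply/(subfx_irreducibleP mx m_neq0) => r rx r_neq0.
by rewrite m_size n_min //; apply/asboolP; exists r.
Qed.

(** [F] is [K[X]/(m)] for an irreducible [m] vanishing at [x], and [z] is the class of [X]; it is an
    abstract model of [K(x)]. *)
Lemma simple_extension x : algebraicOver iota x ->
  exists (F : fieldExtType K) (j : {rmorphism F -> L}) (z : F),
    [/\ is_Kembedding iota j, j z = x
      & forall y : F, exists q : {poly K}, y = (map_poly (in_alg F) q).[z]].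
Proof.
move=> /min_irreducible_poly[m m_irr mx].
have m_neq0 := irredp_neq0 m_irr.
exists (SubFieldExtType mx m_irr), (@subfx_inj _ _ iota x m : {rmorphism _ -> _}).
exists (subfx_root iota x m); split.
- by move=> a; exact: subfx_inj_base.
- exact: subfx_inj_root.
- by move=> y; have [q ->] := subfxEroot mx m_neq0 y; exists q.
Qed.

Lemma horner_Kembedding (F : fieldExtType K) (j : {rmorphism F -> L}) q z :
  is_Kembedding iota j ->
  j (map_poly (in_alg F) q).[z] = (map_poly iota q).[j z].
Proof.
move=> jK; rewrite -horner_map -map_poly_comp; congr (_.[_]).
by apply: eq_map_poly => a /=; rewrite jK.
Qed.

End SimpleExtension.

Section ExtendEmbedding.
Variables (L : closedFieldType).

(* Graph of a field isomorphism between two subfields of L. *)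
Definition iso_graph (G : set (L * L)) : Prop :=
  [/\ G (1, 1),
      forall u v, G u -> G v -> G (u.1 - v.1, u.2 - v.2),
      forall u v, G u -> G v -> G (u.1 / v.1, u.2 / v.2)
    & forall y, G (0, y) -> y = 0].

(** The graph of the isomorphism [b \o a^-1] between the images of [a] and [b]. *)
Definition pair_graph (k : fieldType) (a b : {rmorphism k -> L}) : set (L * L) :=
  [set (a x, b x) | x in [set: k]].

(** The first projection of [G] is a subfield [k] with inclusion [a]. As [G (0, y)] forces [y = 0],
    [G] is the graph of a function on it, which is [b]. *)
Lemma iso_graph_embeddings (G : set (L * L)) : iso_graph G ->
  exists (k : fieldType) (a b : {rmorphism k -> L}), G = pair_graph a b.
Proof.
move=> [G1 GB Gdiv G0].
pose S : {pred L} := fun x => `[< exists y, G (x, y) >].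
have S_divring : divring_closed S.
  split.
  - by apply/asboolP; exists 1.
  - move=> x y /asboolP[x' Gx] /asboolP[y' Gy]; apply/asboolP.
    by exists (x' - y'); exact: (GB _ _ Gx Gy).
  - move=> x y /asboolP[x' Gx] /asboolP[y' Gy]; apply/asboolP.
    by exists (x' / y'); exact: (Gdiv _ _ Gx Gy).
pose Sc : divringClosed L := HB.pack S (GRing.isDivringClosed.Build L S S_divring).
pose k : fieldType := subfield_type Sc.
pose a : {rmorphism k -> L} := @subfield_val _ Sc.
have inj_G x y y' : G (x, y) -> G (x, y') -> y = y'.
  move=> Gy Gy'; apply/eqP; rewrite -subr_eq0; apply/eqP/G0.
  by have := GB _ _ Gy Gy'; rewrite subrr.
have G00 : G (0, 0) by have := GB _ _ G1 G1; rewrite !subrr.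
have GM x x' y y' : G (x, x') -> G (y, y') -> G (x * y, x' * y').
  move=> Gx Gy; have := Gdiv _ _ G1 Gy; rewrite /= !div1r.
  by move/(Gdiv _ _ Gx); rewrite /= !invrK.
have aG (u : k) : {y | G (a u, y)}.
  by apply/cid; case: u => x xS; have /asboolP := xS.
pose b0 u := sval (aG u).
have b0G u : G (a u, b0 u) by rewrite /b0; case: (aG u).
have b0B : zmod_morphism b0.
  move=> u v; apply: inj_G (b0G _) _; rewrite rmorphB.
  exact: (GB _ _ (b0G u) (b0G v)).
have b0M : monoid_morphism b0.
  split; first by apply: inj_G (b0G _) _; rewrite rmorph1.
  by move=> u v; apply: inj_G (b0G _) _; rewrite rmorphM; exact: GM.
pose b : {rmorphism k -> L} := HB.pack b0
  (GRing.isZmodMorphism.Build k L b0 b0B)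
  (GRing.isMonoidMorphism.Build k L b0 b0M).
exists k, a, b; apply/seteqP; split => [[x y] Gxy|_ [u _ <-]]; last exact: b0G.
have xS : x \in Sc by apply/asboolP; exists y.
exists (exist _ x xS) => //; congr pair.
by apply: inj_G Gxy; exact: (b0G (exist _ x xS)).
Qed.

(** The extended graph consists of the pairs [(q(x), q(y))], with coefficients mapped by [a] on the
    left and by [b] on the right. *)
Lemma extend_pair_graph (k : fieldType) (a b : {rmorphism k -> L}) (m : {poly k})
    (x y : L) : irreducible_poly m ->
  root (map_poly a m) x -> root (map_poly b m) y ->
  exists G, [/\ iso_graph G, pair_graph a b `<=` G & G (x, y)].
Proof.
move=> m_irr mx my.
(* If [q] vanishes at [x], its gcd with [m] has the root [x], so is not constant; by irreducibility
   [m] divides [q]. *)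
have eval0 q : (map_poly a q).[x] = 0 -> (map_poly b q).[y] = 0.
  move=> qx; have [/eqP->|q_neq0] := boolP (q == 0).
    by rewrite map_poly0 horner0.
  have : m %| q.
    have [_ /(_ (gcdp m q))] := m_irr.
    rewrite dvdp_gcdl => /(_ _ isT) h; rewrite -(eqp_dvdl q (h _)) ?dvdp_gcdr //.
    rewrite neq_ltn; apply/orP; right; rewrite -(size_map_poly a) gcdp_map.
    apply: (@root_size_gt1 _ x); last by rewrite root_gcd mx; exact/eqP.
    by rewrite gcdp_eq0 !map_poly_eq0 negb_and q_neq0 orbT.
  by case/dvdpP=> r ->; rewrite rmorphM hornerM (eqP my) mulr0.
have [F [j [z [jK jz genz]]]] : exists (F : fieldExtType k) (j : {rmorphism F -> L}) (z : F),
    [/\ is_Kembedding a j, j z = x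
      & forall y : F, exists q : {poly k}, y = (map_poly (in_alg F) q).[z]].
  by apply: simple_extension; exists m => //; exact: irredp_neq0.
(* Closure under division: the inverse of [q(x)] is some [r(x)], and [r q - 1], vanishing at [x],
   also vanishes at [y]. *)
have inv_eval q : exists r, (map_poly a r).[x] = (map_poly a q).[x]^-1
                         /\ (map_poly b r).[y] = (map_poly b q).[y]^-1.
  have [qx0|qx_neq0] := eqVneq (map_poly a q).[x] 0.
    by exists 0; rewrite qx0 (eval0 _ qx0) invr0 !map_poly0 !horner0.
  have [r rE] := genz (map_poly (in_alg F) q).[z]^-1.
  have rx : (map_poly a r).[x] = (map_poly a q).[x]^-1.
    by rewrite -jz -!(horner_Kembedding _ _ jK) -rE fmorphV.
  exists r; split => //; have : (map_poly b (r * q - 1)).[y] = 0.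
    apply: eval0; rewrite rmorphB rmorphM rmorph1 /= !hornerE rx mulVf //.
    by rewrite subrr.
  rewrite rmorphB rmorphM rmorph1 /= !hornerE => /subr0_eq rq1.
  have qy_neq0 : (map_poly b q).[y] != 0.
    by apply: contra_eq_neq rq1 => ->; rewrite mulr0 eq_sym oner_neq0.
  by apply: (mulIf qy_neq0); rewrite rq1 mulVf.
exists [set ((map_poly a q).[x], (map_poly b q).[y]) | q in [set: {poly k}]].
split; last by exists 'X => //; rewrite !map_polyX !hornerX.
  split.
  - by exists 1 => //; rewrite !rmorph1 !hornerC.
  - move=> _ _ [q _ <-] [r _ <-]; exists (q - r) => //=.
    by rewrite !rmorphB !hornerE.
  - move=> _ _ [q _ <-] [r _ <-]; have [s [sx sy]] := inv_eval r.
    by exists (q * s) => //=; rewrite !rmorphM !hornerE sx sy.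
  - by move=> y' [q _ [/eval0 + <-]].
by move=> _ [u _ <-]; exists u%:P => //; rewrite !map_polyC !hornerC.
Qed.

Variables (K : fieldType) (iota : {rmorphism K -> L}).
Hypothesis iota_closure : is_algebraic_closure iota.

(** Zorn's lemma gives a maximal graph. An [x] outside its domain is algebraic over that domain, and
    the transported irreducible polynomial has a root in [L], so the graph could be extended. *)
Lemma algebraic_iso_graph_total (G : set (L * L)) : iso_graph G ->
  pair_graph iota iota `<=` G ->
  exists2 H, iso_graph H /\ G `<=` H & forall x, exists y, H (x, y).
Proof.
move=> G_iso Giota.
(* Adding [G] inside the predicate lets it hold for the union of the empty chain. *)
pose P H := iso_graph (H `|` G).
have P_bigcup (C : set (set (L * L))) : C `<=` P -> total_on C subset ->
    P (\bigcup_(X in C) X).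
  move=> CP Ctot; have [->|/set0P[X0 CX0]] := eqVneq C set0.
    by rewrite /P bigcup_set0 set0U.
  rewrite /P; have -> : \bigcup_(X in C) X `|` G = \bigcup_(X in C) (X `|` G).
    apply/seteqP; split=> [u [[X CX Xu]|Gu]|u [X CX [Xu|Gu]]].
    - by exists X => //; left.
    - by exists X0 => //; right.
    - by left; exists X.
    - by right.
  have common u v : (\bigcup_(X in C) (X `|` G)) u -> (\bigcup_(X in C) (X `|` G)) v ->
      exists2 X, C X & (X `|` G) u /\ (X `|` G) v.
    move=> [X CX Xu] [Y CY Yv]; have [XY|YX] := Ctot _ _ CX CY.
      by exists Y => //; split => //; apply: setSU Xu.
    by exists X => //; split => //; apply: setSU Yv.
  split.
  - by exists X0 => //; have [] := CP _ CX0.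
  - move=> u v /common h /h{h}[X CX [Xu Xv]]; exists X => //.
    by have [_ + _ _] := CP _ CX; exact.
  - move=> u v /common h /h{h}[X CX [Xu Xv]]; exists X => //.
    by have [_ _ + _] := CP _ CX; exact.
  - by move=> y [X CX]; have [_ _ _] := CP _ CX; exact.
have [H [PH H_max]] := Zorn_bigcup P_bigcup.
exists (H `|` G); first by split => // u; right.
move=> x; apply: contrapT => x_dom.
have [k [a [b HE]]] := iso_graph_embeddings PH.
(* An annihilator of [x] over [K] lifts coefficientwise to [k], since the graph contains the
   diagonal over [iota]. *)
have x_alg : algebraicOver a x.
  have [q q_neq0 qx] := iota_closure x.
  have lift c : {d | a d = iota c}.
    apply/cid; have : (pair_graph a b) (iota c, iota c).
      by rewrite -HE; right; apply: Giota; exists c.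
    by case=> d _ [<- _]; exists d.
  pose r := \poly_(i < size q) sval (lift q`_i).
  have rE : map_poly a r = map_poly iota q.
    apply/polyP => i; rewrite !coef_map coef_poly /=.
    case: ltnP => [_|qi]; first by case: (lift _).
    by rewrite nth_default // !rmorph0.
  exists r; last by rewrite rE.
  by rewrite -(map_poly_eq0 a) rE map_poly_eq0.
have [m m_irr mx] := min_irreducible_poly x_alg.
have [y my] : exists y, root (map_poly b m) y.
  apply/closed_rootP; rewrite size_map_poly; case: m_irr => + _.
  by apply: contraTneq => ->.
have [G' [G'_iso HG' G'xy]] := extend_pair_graph m_irr mx my.
apply: (H_max G').
  split; last first.
    by move=> G'H; apply: x_dom; exists y; left; exact: G'H.
  by move=> u Hu; apply: HG'; rewrite -HE; left.
rewrite /P; suff -> : G' `|` G = G' by [].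
by apply/setUidPl => u Gu; apply: HG'; rewrite -HE; right.
Qed.

(** For surjectivity at [y]: [s] maps the finite set of roots of an annihilator of [y] injectively
    into itself, hence onto itself. *)
Lemma algebraic_endomorphism_bij (s : L -> L) : zmod_morphism s ->
  GRing.monoid_morphism s -> (forall a, s (iota a) = iota a) -> bijective s.
Proof.
move=> sB sM siota.
pose f : {rmorphism L -> L} := HB.pack s
  (GRing.isZmodMorphism.Build L L s sB) (GRing.isMonoidMorphism.Build L L s sM).
have f_inj : injective f by exact: fmorph_inj.
have s_surj y : {x | s x = y}.
  apply/cid; have [q q_neq0 qy] := iota_closure y.
  have [rs rsE] := closed_field_poly_normal (map_poly iota q).
  have q0 : lead_coef (map_poly iota q) != 0.
    by rewrite lead_coef_eq0 map_poly_eq0.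
  have memr z : (z \in rs) = root (map_poly iota q) z.
    by rewrite rsE rootZ // root_prod_XsubC.
  pose us := undup rs.
  have us_stable z : z \in us -> f z \in us.
    rewrite !mem_undup !memr => qz.
    have -> : map_poly iota q = map_poly f (map_poly iota q).
      by rewrite -map_poly_comp; apply: eq_map_poly => c; exact/esym/siota.
    by rewrite fmorph_root.
  have : y \in us by rewrite mem_undup memr.
  have f_us : {subset map f us <= us} by move=> _ /mapP[z /us_stable + ->].
  have /uniq_min_size : uniq (map f us) by rewrite map_inj_uniq ?undup_uniq.
  by move=> /(_ _ f_us); rewrite size_map leqnn => /(_ isT)[_ <-] /mapP[x _ ->]; exists x.
exists (fun y => sval (s_surj y)).
  by move=> x; case: s_surj => z /= /f_inj.
by move=> y; case: s_surj.
Qed.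

Lemma extend_iso_graph (G : set (L * L)) : iso_graph G ->
  pair_graph iota iota `<=` G ->
  exists2 s, abs_galois iota s & forall u, G u -> s u.1 = u.2.
Proof.
move=> G_iso Giota.
have [H [H_iso GH] H_tot] := algebraic_iso_graph_total G_iso Giota.
have [k [a [b HE]]] := iso_graph_embeddings H_iso.
pose s x := sval (cid (H_tot x)).
have sH x : H (x, s x) by rewrite /s; case: cid.
have sE x y : H (x, y) -> s x = y.
  move=> Hy; have := sH x; move: Hy; rewrite HE => -[u _ [<- <-]] [v _ [/fmorph_inj->]].
  by [].
have s_a u : s (a u) = b u by apply: sE; rewrite HE; exists u.
have a_surj x : exists u, a u = x.
  by have := sH x; rewrite HE => -[u _ [<- _]]; exists u.
have sB : zmod_morphism s.
  move=> x y; have [u <-] := a_surj x; have [v <-] := a_surj y.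
  by rewrite -rmorphB !s_a rmorphB.
have sM : GRing.monoid_morphism s.
  split; first by have := s_a 1; rewrite !rmorph1.
  move=> x y; have [u <-] := a_surj x; have [v <-] := a_surj y.
  by rewrite -rmorphM !s_a rmorphM.
have siota c : s (iota c) = iota c by apply: sE; apply/GH/Giota; exists c.
exists s; first by split => //; exact: algebraic_endomorphism_bij.
by move=> [x y] /GH /sE.
Qed.

(** The minimal polynomial of [x] over [F] has a second root [y], being of degree at least 2 and
    separable; the isomorphism sending [x] to [y] extends to [L]. *)
Lemma galois_moves_outside (F : fieldExtType K) (j : {rmorphism F -> L}) x :
  is_Kembedding iota j -> (forall n, (0 < n)%N -> n%:R != 0 :> L) -> ~ range j x ->
  exists2 s, abs_galois iota s & (forall y, s (j y) = j y) /\ s x <> x.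
Proof.
move=> jK char0 xj.
have x_alg : algebraicOver j x.
  have [q q_neq0 qx] := iota_closure x; exists (map_poly (in_alg F) q).
    by rewrite map_poly_eq0.
  rewrite -map_poly_comp (eq_map_poly (g := iota)) // => c; exact: jK.
have [m m_irr mx] := min_irreducible_poly x_alg.
have m_neq0 := irredp_neq0 m_irr.
have m_min := (subfx_irreducibleP mx m_neq0).2 m_irr.
have size_m : (2 < size m)%N.
  rewrite ltnNge; apply/negP => m_le2.
  have m_size : size m = 2 by apply/eqP; rewrite eqn_leq m_le2; case: m_irr.
  have m1 : j m`_1 != 0.
    by rewrite fmorph_eq0; move: m_neq0; rewrite -lead_coef_eq0 lead_coefE m_size.
  apply: xj; exists (- m`_0 / m`_1) => //; rewrite fmorph_div rmorphN.
  move: mx => /eqP; rewrite horner_coef size_map_poly m_size big_ord_recr big_ord1 /=.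
  rewrite !coef_map expr0 mulr1 expr1 => /eqP; rewrite addr_eq0 => /eqP->.
  by rewrite opprK mulrC mulKf.
(* Were [x] the only root, it would be a multiple one, hence a root of the derivative, which is
   nonzero in characteristic 0 and of smaller size than [m]. *)
have [y my xy] : exists2 y, root (map_poly j m) y & y <> x.
  apply: contrapT => my.
  have [rs rsE] := closed_field_poly_normal (map_poly j m).
  have lead_neq0 : lead_coef (map_poly j m) != 0 by rewrite lead_coef_eq0 map_poly_eq0.
  have all_x z : z \in rs -> z = x.
    move=> zrs; apply: contrapT => zx; apply: my; exists z => //.
    by rewrite rsE rootZ // root_prod_XsubC.
  have : (2 < size (map_poly j m))%N by rewrite size_map_poly.
  rewrite rsE size_scale // size_prod_XsubC.
  case: rs all_x rsE => [|r1 [|r2 rs]] // all_x rsE _.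
  have r1x : r1 = x by apply: all_x; rewrite mem_head.
  have r2x : r2 = x by apply: all_x; rewrite !in_cons eqxx orbT.
  have root_deriv : root (map_poly j m^`()) x.
    have [q mE] : exists q, map_poly j m = ('X - x%:P) * (('X - x%:P) * q).
      exists (lead_coef (map_poly j m) *: \prod_(z <- rs) ('X - z%:P)).
      by rewrite [LHS]rsE !big_cons r1x r2x !scalerAr.
    rewrite -deriv_map mE derivM derivXsubC mul1r rootE hornerD !hornerM.
    by rewrite !hornerXsubC subrr !mul0r addr0.
  have m'_neq0 : m^`() != 0.
    apply/eqP => /(congr1 (fun q : {poly F} => j q`_(size m).-2)).
    rewrite coef_deriv coef0 rmorph0 rmorphMn /=.
    have -> : ((size m).-2.+1 = (size m).-1)%N by case: (size m) size_m => [|[]].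
    rewrite -mulr_natr => /eqP; rewrite mulf_eq0 fmorph_eq0 -lead_coefE lead_coef_eq0.
    rewrite (negPf m_neq0) /=; apply/negP/char0.
    by case: (size m) size_m => [|[]].
  have := m_min _ root_deriv m'_neq0.
  by rewrite leqNgt lt_size_deriv.
have [G [G_iso jG Gxy]] := extend_pair_graph m_irr mx my.
have Giota : pair_graph iota iota `<=` G.
  by move=> _ [c _ <-]; apply: jG; exists (c%:A) => //; rewrite !jK.
have [s s_gal sG] := extend_iso_graph G_iso Giota.
exists s => //; split=> [z|]; last by rewrite (sG _ Gxy).
by apply: (sG (j z, j z)); apply: jG; exists z.
Qed.

End ExtendEmbedding.

(** * The field of p-adic numbers and its finite extensions *)

Section PadicField.
Variables (R : realType) (p : nat) (Qp : fieldType) (vp : Qp -> \bar R).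
Hypotheses (p_prime : prime p) (Qp_padic : is_padic_field p vp).

Lemma padic_val : is_valuation vp. Proof. by case: Qp_padic. Qed.
Lemma padic_valp : vp p%:R = 1%E. Proof. by case: Qp_padic. Qed.

Let v_val := padic_val.
Let vp1 := padic_valp.

Lemma val_ge_nat_eq0 x : (forall m : nat, (m%:R%:E <= vp x)%E) -> x = 0.
Proof.
move=> h; apply/eqP/negPn/negP => x0; move: h; rewrite (val_finE v_val x0).
move=> /(_ (Num.bound `|fine (vp x)|)); rewrite lee_fin leNgt => /negP; apply.
exact: le_lt_trans (ler_norm _) (archi_boundP (normr_ge0 _)).
Qed.

Lemma padic_val_nat n : (0 < n)%N -> vp n%:R = (logn p n)%:R%:E.
Proof.
move=> n_gt0; have [m pm nE] := pfactor_coprime p_prime n_gt0.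
rewrite {1}nE natrM natrX (valM v_val) (valX v_val) vp1 mule1.
by rewrite (val_coprime v_val p_prime vp1 pm) add0e.
Qed.

Lemma padic_val_intr (z : int) : vp z%:~R = vp `|z|%N%:R.
Proof. by case: z => n //=; rewrite NegzE mulrNz (valN v_val). Qed.

Lemma intr_neq0 (z : int) : z != 0 -> z%:~R != 0 :> Qp.
Proof.
have h n : (0 < n)%N -> n%:R != 0 :> Qp by exact: (char0_of_val v_val p_prime vp1).
by case: z => n z0; rewrite ?NegzE ?mulrNz ?oppr_eq0; apply: h; case: n z0.
Qed.

Lemma padic_val_ratr (q : rat) : q != 0 ->
  vp (ratr q) = ((logn p `|numq q|)%:R - (logn p `|denq q|)%:R)%:E.
Proof.
move=> q0; rewrite /ratr (val_div v_val) ?intr_neq0 ?denq_neq0 //.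
by rewrite !padic_val_intr !padic_val_nat ?absz_gt0 ?numq_eq0 ?denq_neq0.
Qed.

Lemma padic_approx x (m : nat) : exists q : rat, (m%:R%:E <= vp (x - ratr q)%R)%E.
Proof. by case: Qp_padic => _ _ + _; exact. Qed.

(** A rational number close enough to [x] has the same valuation as [x]. *)
Lemma padic_val_int x : x != 0 -> exists z : int, vp x = (z%:~R)%:E.
Proof.
move=> x0; have [q qx] := padic_approx x (Num.bound `|fine (vp x)|).
have lt_x : (vp x < vp (x - ratr q))%E.
  apply: lt_le_trans qx; rewrite (val_finE v_val x0) lte_fin.
  exact: le_lt_trans (ler_norm _) (archi_boundP (normr_ge0 _)).
have vq : vp (ratr q) = vp x.
  have := valD_lt v_val (y := - (x - ratr q)) (x := x).
  by rewrite (valN v_val) subKr; exact.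
have q0 : q != 0.
  apply: contraNneq x0 => q0.
  have r0 : ratr q = 0 :> Qp by rewrite q0 /ratr mul0r.
  by move: lt_x; rewrite -vq r0 (val0 v_val) ltNge leey.
exists ((logn p `|numq q|)%:Z - (logn p `|denq q|)%:Z).
by rewrite -vq padic_val_ratr // rmorphB.
Qed.

Section Fermat.
Hypothesis p_odd : odd p.

(* The elements satisfying Fermat's congruence form a ring closed under
   inverses of units; they contain the integers and are closed in Qp. *)
Let fermat x := (0 <= vp x)%E /\ (1 <= vp (x ^+ p - x)%R)%E.

Let fermatD x y : fermat x -> fermat y -> fermat (x + y).
Proof.
move=> [x0 fx] [y0 fy]; split; first exact: (val_geD v_val).
have -> : (x + y) ^+ p - (x + y) =
    ((x + y) ^+ p - x ^+ p - y ^+ p) + ((x ^+ p - x) + (y ^+ p - y)) by ring.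
apply: (val_geD v_val); last exact: (val_geD v_val).
have := val_frobenius v_val p_prime vp1 1 x0 y0; rewrite expn1; apply: le_trans.
by rewrite -addeA leeDl // adde_ge0.
Qed.

Let fermatN x : fermat x -> fermat (- x).
Proof.
move=> [x0 fx]; split; first by rewrite (valN v_val).
by rewrite exprNn -signr_odd p_odd expr1 mulN1r -opprD (valN v_val).
Qed.

Let fermatM x y : fermat x -> fermat y -> fermat (x * y).
Proof.
move=> [x0 fx] [y0 fy]; split; first exact: (valM_ge0 v_val).
have -> : (x * y) ^+ p - x * y = (x ^+ p - x) * y ^+ p + x * (y ^+ p - y).
  by rewrite exprMn; ring.
apply: (val_geD v_val); rewrite (valM v_val).
  by apply: (le_trans fx); rewrite leeDl // (valX_ge0 v_val).
by apply: (le_trans fy); rewrite leeDr.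
Qed.

Let fermatV x : vp x = 0%E -> fermat x -> fermat x^-1.
Proof.
move=> vx [x0 fx]; have x_neq0 := val_eq0_neq0 v_val vx.
split; first by rewrite (valV v_val) // vx oppe0.
have -> : x^-1 ^+ p - x^-1 = - (x ^+ p - x) / (x ^+ p * x).
  rewrite exprVn; field; by rewrite x_neq0 expf_neq0.
rewrite (val_div v_val) ?mulf_neq0 ?expf_neq0 // (valN v_val) (valM v_val).
by rewrite (valX v_val) vx mule0 adde0 sube0.
Qed.

Let fermat_nat n : fermat n%:R.
Proof.
elim: n => [|n IH]; last rewrite -natr1; last apply: fermatD => //; split.
- by rewrite (val0 v_val) leey.
- by rewrite expr0n gtn_eqF ?prime_gt0 // subrr (val0 v_val) leey.
- by rewrite (val1 v_val).
- by rewrite expr1n subrr (val0 v_val) leey.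
Qed.

(** Modulo [p], [x] is a rational number of nonnegative valuation, that is, a quotient of an integer
    by an integer prime to [p]. *)
Lemma padic_fermat x : (0 <= vp x)%E -> (1 <= vp (x ^+ p - x)%R)%E.
Proof.
have fermat_int (z : int) : fermat z%:~R.
  case: z => n; [exact: fermat_nat|rewrite NegzE mulrNz].
  by apply: fermatN; exact: fermat_nat.
move=> x0; have [q qx] := padic_approx x 1.
have y0 : (0 <= vp (x - ratr q)%R)%E by apply: le_trans qx; rewrite lee_fin.
have fy : fermat (x - ratr q).
  split => //; apply: (val_geB v_val) => //.
  rewrite -(prednK (prime_gt0 p_prime)) exprS (valM v_val).
  by apply: (le_trans qx); rewrite leeDl // (valX_ge0 v_val).
have vq0 : (0 <= vp (ratr q))%E.
  have -> : ratr q = x - (x - ratr q) by rewrite subKr.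
  exact: (val_geB v_val).
suff fq : fermat (ratr q) by rewrite -(subrK (ratr q) x); apply fermatD.
have [->|q_neq0] := eqVneq q 0; first by rewrite /ratr mul0r; exact: (fermat_nat 0).
rewrite /ratr; apply: fermatM => //; apply: fermatV => //.
rewrite padic_val_intr; apply: (val_coprime v_val p_prime vp1).
(* If [p] divided the denominator it would not divide the numerator, and the valuation would be
   negative. *)
rewrite prime_coprime //; apply/negP => p_den.
move: vq0; rewrite padic_val_ratr // lee_fin subr_ge0 ler_nat.
have -> : logn p `|numq q| = 0%N.
  apply/eqP; rewrite -leqn0 leqNgt logn_gt0; apply/negP.
  rewrite mem_primes => /and3P[_ _ p_num].
  have := coprime_num_den q; rewrite /coprime => /eqP g1.
  have : (p %| 1)%N by rewrite -g1 dvdn_gcd p_num.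
  by rewrite dvdn1 => /eqP p1; move: p_prime; rewrite p1.
by rewrite leqn0 -leqn0 leqNgt logn_gt0 mem_primes p_prime p_den absz_gt0 denq_neq0.
Qed.

End Fermat.

Lemma val_subrX1 (E : fieldType) (v : E -> \bar R) (hv : is_valuation v) (x : E) n :
  (0 <= v x)%E -> (v (x - 1)%R <= v (x ^+ n - 1)%R)%E.
Proof.
move=> x0; rewrite subrX1 (valM hv) leeDl //.
by apply: (val_ge_sum hv) => i _; exact: (valX_ge0 hv).
Qed.

Lemma val_principal_unit (E : fieldType) (v : E -> \bar R) (hv : is_valuation v) (s : E) :
  (1 <= v (s - 1)%R)%E -> v s = 0%E.
Proof.
move=> s1; rewrite -(subrK 1 s) addrC (valD_lt hv) ?(val1 hv) //.
by apply: lt_le_trans s1; rewrite lte_fin.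
Qed.

(* The root is the p-adic limit of s^((p^k+1)/2). *)
Lemma padic_principal_sqrt s : odd p -> (1 <= vp (s - 1)%R)%E ->
  exists2 r, r ^+ 2 = s & (1 <= vp (r - 1)%R)%E.
Proof.
move=> p_odd s1; have vs0 := val_principal_unit v_val s1.
have vX n : (0 <= vp (s ^+ n))%E by rewrite (valX_ge0 v_val) // vs0.
pose c k := ((p ^ k).+1)./2; pose x k := s ^+ c k.
have odd_pk k : odd (p ^ k) by rewrite oddX p_odd orbT.
have cE k : (c k * 2 = (p ^ k).+1)%N.
  by rewrite muln2 -[RHS]odd_double_half /= odd_pk.
(* As [c k - c i = p^i (p^(k-i) - 1)/2], the quotient [x k / x i] is a power of [s ^+ (p ^ i)],
   which is close to 1. *)
have x_cauchy i k : (i <= k)%N -> (i%:R%:E <= vp (x k - x i)%R)%E.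
  move=> ik; have [e ckE] : exists e, (c k = c i + p ^ i * e)%N.
    exists (p ^ (k - i))./2.
    have := odd_double_half (p ^ (k - i)); rewrite odd_pk add1n => pE.
    apply/eqP; rewrite -(eqn_pmul2r (isT : 0 < 2)%N) mulnDl !cE -mulnA muln2 addSn eqSS.
    by rewrite -mulnS pE -expnD subnKC.
  rewrite /x ckE exprD -{2}[s ^+ c i]mulr1 -mulrBr (valM v_val) exprM.
  apply: (@le_trans _ _ (vp (s ^+ (p ^ i) - 1))).
    apply: le_trans (val_principal_unit_pow v_val p_prime vp1 i s1).
    by rewrite lee_fin ler_nat.
  by apply: (le_trans (val_subrX1 v_val e (vX _))); rewrite leeDr.
have [r r_lim] : exists r, val_converges vp x r.
  case: Qp_padic => _ _ _; apply => m; exists m => i k mi mk.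
  wlog ik : i k mi mk / (i <= k)%N.
    by move=> h; have [/h->//|/ltnW/h] := leqP i k; rewrite (valBC v_val); exact.
  rewrite (valBC v_val); apply: le_trans (x_cauchy _ _ ik).
  by rewrite lee_fin ler_nat.
exists r.
  apply/eqP; rewrite -subr_eq0; apply/eqP/val_ge_nat_eq0 => m.
  have [N /(_ (maxn N m)) rN] := r_lim m; move: rN; rewrite leq_maxl => /(_ isT).
  set k := maxn N m => rk.
  have vr0 : (0 <= vp r)%E.
    have -> : r = x k - (x k - r) by rewrite subKr.
    apply: (val_geB v_val); first exact: vX.
    by apply: le_trans rk; rewrite lee_fin.
  (* Here [x k ^+ 2 = s ^+ (p ^ k).+1], so the first difference is [s (s^(p^k) - 1)]. *)
  have -> : r ^+ 2 - s = (x k ^+ 2 - s) - (x k - r) * (x k + r) by ring.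
  apply: (val_geB v_val).
    rewrite /x -exprM cE exprS -[X in _ - X]mulr1 -mulrBr (valM v_val).
    apply: (@le_trans _ _ (k.+1%:R%:E)).
      by rewrite lee_fin ler_nat leqW // leq_maxr.
    apply: (le_trans (val_principal_unit_pow v_val p_prime vp1 k s1)).
    by rewrite vs0 add0e.
  rewrite (valM v_val); apply: (le_trans rk); rewrite leeDl //.
  by apply: (val_geD v_val) => //; exact: vX.
have [N /(_ N (leqnn _)) rN] := r_lim 1.
have -> : r - 1 = (x N - 1) - (x N - r) by ring.
apply: (val_geB v_val) => //; apply: (le_trans s1).
by apply: (val_subrX1 v_val); rewrite vs0.
Qed.

(** The square root is again a principal unit, so the choice can be iterated inside the subtype
    [T]. *)
Lemma padic_principal_sqrt_chain s : odd p -> (1 <= vp (s - 1)%R)%E ->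
  exists u : nat -> Qp, [/\ u 0%N = s, forall n, u n.+1 ^+ 2 = u n
    & forall n, (1 <= vp (u n - 1)%R)%E].
Proof.
move=> p_odd s1; pose T := {x : Qp | (1 <= vp (x - 1)%R)%E}.
have step (x : T) : {y : T | sval y ^+ 2 = sval x}.
  apply/cid; case: x => x x1; have [r rx r1] := padic_principal_sqrt p_odd x1.
  by exists (exist _ r r1).
pose u := fix u n : T := if n is m.+1 then sval (step (u m)) else exist _ s s1.
exists (fun n => sval (u n)); split => // n; last by case: (u n).
by rewrite /=; case: (step (u n)).
Qed.

End PadicField.

(** * Finite extensions: value groups, roots of unity and inertia *)

Lemma finite_ext_annihilator (K : fieldType) (F : fieldExtType K) (x : F) :
  exists q : {poly K}, [/\ q != 0, (size q <= (\dim {:F}).+1)%N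
    & root (map_poly (in_alg F) q) x].
Proof.
have /polyOver1P[q qE] := minPolyOver 1 x.
exists q; split.
- by rewrite -(map_poly_eq0 (in_alg F)) -qE monic_neq0 // monic_minPoly.
- rewrite -(size_map_poly (in_alg F)) -qE size_minPoly ltnS adjoin_degreeE dimv1 divn1.
  by rewrite dimvS // subvf.
- by rewrite -qE root_minPoly.
Qed.

Lemma val_exprz (R : realType) (E : fieldType) (v : E -> \bar R) (hv : is_valuation v)
    (x : E) (k : int) : x != 0 -> v (x ^ k) = (k%:~R * fine (v x))%:E.
Proof.
move=> x0; case: k => n; rewrite ?NegzE -?exprnN ?exprnP.
  by rewrite -exprnP (valX hv) {1}(val_finE hv x0).
rewrite exprnN -invr_expz (valV hv) ?expfz_neq0 // -exprnP (valX hv).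
by rewrite {1}(val_finE hv x0) -EFinM -EFinN mulrNz mulNr.
Qed.

Section FiniteExtension.
Variables (R : realType) (p : nat) (Qp : fieldType) (vp : Qp -> \bar R).
Hypotheses (p_prime : prime p) (p_odd : odd p) (Qp_padic : is_padic_field p vp).
Variables (L : closedFieldType) (iota : {rmorphism Qp -> L}).
Hypothesis iota_closure : is_algebraic_closure iota.
Variable w : L -> \bar R.
Hypotheses (w_val : is_valuation w) (w_ext : forall a, w (iota a) = vp a).

Let v_val := padic_val Qp_padic.

Lemma ext_valp : w p%:R = 1%E.
Proof. by rewrite -(rmorph_nat iota) w_ext (padic_valp Qp_padic). Qed.

Let wp1 := ext_valp.

Section Embedded.
Variables (F : fieldExtType Qp) (j : {rmorphism F -> L}).
Hypothesis jK : is_Kembedding iota j.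

(* In an annihilating relation of degree at most d two nonzero terms have the
   same valuation, so (i - k) w(x) is an integer with 0 < |i - k| <= d. *)
Lemma finite_ext_val_denominator x : x != 0 ->
  exists z : int, w (j x) = (z%:~R / ((\dim {:F})`!)%:R)%:E.
Proof.
move=> x0; have jx0 : j x != 0 by rewrite fmorph_eq0.
have [q [q_neq0 q_size qx]] := finite_ext_annihilator x.
pose T (i : 'I_(size q)) := iota q`_i * j x ^+ i.
have T0 : \sum_i T i = 0.
  transitivity (j (map_poly (in_alg F) q).[x]); last by rewrite (eqP qx) rmorph0.
  rewrite (horner_Kembedding _ _ jK) horner_coef size_map_poly.
  by apply: eq_bigr => i _; rewrite coef_map.
have TE i : T i != 0 -> exists z : int, w (T i) = (z%:~R + i%:R * fine (w (j x)))%:E.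
  rewrite mulf_eq0 negb_or fmorph_eq0 => /andP[qi0 _].
  have [z qz] := padic_val_int p_prime Qp_padic qi0; exists z.
  by rewrite (valM w_val) (valX w_val) w_ext qz {1}(val_finE w_val jx0).
(* If the nonzero terms had distinct valuations, their sum, which is 0, would have finite
   valuation. *)
have [i [k [ik [Ti Tk] wik]]] :
    exists i k, [/\ i != k, T i != 0 /\ T k != 0 & w (T i) = w (T k)].
  apply: contrapT => noik.
  have q_gt0 : (0 < size q)%N by rewrite size_poly_gt0.
  have lt_q : ((size q).-1 < size q)%N by rewrite prednK.
  have T_lead : T (Ordinal lt_q) != 0.
    by rewrite /T mulf_neq0 ?expf_neq0 // fmorph_eq0 -lead_coefE lead_coef_eq0.
  have : (w (\sum_k T k) <= w (T (Ordinal lt_q)))%E.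
    apply: (val_sum_distinct w_val) => i k ik Ti Tk; apply/eqP => wik.
    by apply: noik; exists i, k.
  by rewrite T0 (val0 w_val) leye_eq (val_finE w_val T_lead).
wlog {ik} ik : i k Ti Tk wik / (i < k)%N.
  move=> H; have : (i != k :> nat) by [].
  by rewrite neq_ltn => /orP[/H|/H]; apply.
have [a Ta] := TE _ Ti; have [b Tb] := TE _ Tk.
pose m := (k - i)%N; have m_gt0 : (0 < m)%N by rewrite subn_gt0.
have /dvdnP[c cE] : (m %| (\dim {:F})`!)%N.
  apply: dvdn_fact; rewrite m_gt0 /=; apply: leq_trans (leq_subr _ _) _.
  by rewrite -ltnS; apply: leq_trans q_size.
have mw : m%:R * fine (w (j x)) = (a - b)%:~R.
  move: wik; rewrite Ta Tb => -[/eqP].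
  rewrite natrB 1?ltnW // mulrBl rmorphB /= => /eqP h.
  by apply/eqP; rewrite subr_eq addrAC h addrAC subrr add0r.
exists ((a - b) * c%:Z); rewrite (val_finE w_val jx0); congr (_%:E).
have D0 : ((\dim {:F})`!)%:R != 0 :> R by rewrite pnatr_eq0 -lt0n fact_gt0.
apply: (mulIf D0); rewrite divfK // intrM -mw cE natrM -pmulrn.
by ring.
Qed.

(** The value group lies in [D^-1 Z] and is generated by its least positive element [n / D]; since
    [w p = 1], [n] divides [D], and [e = D / n]. *)
Lemma normalizing_factor_exists : exists e, normalizing_factor w j e.
Proof.
set D := ((\dim {:F})`!)%N; have D_gt0 : (0 < D)%N by exact: fact_gt0.
have D_neq0 : D%:R != 0 :> R by rewrite pnatr_eq0 -lt0n.
pose P n := (0 < n)%N && `[< exists2 x : F, x != 0 & w (j x) = (n%:R / D%:R)%:E >].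
have exP : exists n, P n.
  exists D; rewrite /P D_gt0; apply/asboolP; exists p%:R.
    by rewrite -(fmorph_eq0 j) rmorph_nat (p_neq0 w_val wp1).
  by rewrite rmorph_nat wp1 divff.
case: (ex_minnP exP) => n /andP[n_gt0 /asboolP[y y0 wy]] n_min.
have jy0 : j y != 0 by rewrite fmorph_eq0.
(* Euclidean division: dividing [x] by a power of [y] leaves the valuation [r / D] with [r < n], so
   [r = 0] by minimality. *)
have n_dvd (x : F) (z : int) : x != 0 -> w (j x) = (z%:~R / D%:R)%:E -> (n %| z)%Z.
  move=> x0 wx; rewrite dvdz_eq -subr_eq0 -[_ - z]opprB oppr_eq0; apply/negPn/negP.
  have -> : z - (z %/ n)%Z * n = (z %% n)%Z by rewrite {1}(divz_eq z n) addrAC subrr add0r.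
  have : (0 <= z %% n)%Z by rewrite modz_ge0 // -lt0n.
  have : (z %% n < n)%Z by rewrite ltz_pmod.
  case zn : (z %% n)%Z => [r|//] r_lt _ r0.
  suff : P r by move/n_min; rewrite leqNgt -ltz_nat r_lt.
  rewrite /P lt0n; apply/andP; split => //; apply/asboolP.
  exists (x / y ^ (z %/ n)%Z); first by rewrite mulf_neq0 ?invr_eq0 ?expfz_neq0.
  rewrite fmorph_div (val_div w_val) rmorphXz ?unitfE ?expfz_neq0 //.
  rewrite (val_exprz w_val _ jy0) wy wx -EFinB /=; congr (_%:E).
  rewrite mulrA -mulrBl; congr (_ / _).
  have -> : r%:R = (z - (z %/ n)%Z * n)%:~R :> R.
    by rewrite {1}(divz_eq z n) addrAC subrr add0r zn.
  by rewrite rmorphB rmorphM.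
have [e DE] : exists e, D = (e * n)%N.
  apply/dvdnP; have := n_dvd p%:R D; rewrite /dvdz /=; apply.
    by rewrite -(fmorph_eq0 j) rmorph_nat (p_neq0 w_val wp1).
  by rewrite rmorph_nat wp1 divff.
have e_gt0 : (0 < e)%N by move: D_gt0; rewrite DE muln_gt0 => /andP[].
have en : e%:R * (n%:R / D%:R) = 1 :> R by rewrite mulrA -natrM -DE divff.
exists e; split => //; apply/seteqP; split => [_ [x /= x0 <-]|_ [k _ <-]].
  have [z wx] := finite_ext_val_denominator x0.
  have /dvdzP[k kE] := n_dvd _ _ x0 wx; exists k => //.
  rewrite wx -EFinM kE intrM -pmulrn; congr EFin.
  by rewrite -[LHS]mulr1 -[X in _ * X = _]en; ring.
exists (y ^ k); first by rewrite /= expfz_neq0.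
rewrite rmorphXz ?unitfE // (val_exprz w_val _ jy0) wy -EFinM /=.
by rewrite mulrCA en mulr1.
Qed.

End Embedded.

(** A polynomial with at least as many distinct roots modulo the maximal ideal as its size is zero
    modulo that ideal. Factors ['X - a%:P] are split off in [L] itself, avoiding the residue
    field. *)
Lemma val_gt0_of_roots (q : {poly L}) (rs : seq L) : (size q <= size rs)%N ->
  (forall a, a \in rs -> (0 <= w a)%E) ->
  (forall a, a \in rs -> (0 < w q.[a])%E) ->
  pairwise (fun a b => w (a - b) == 0%E) rs ->
  forall i, (0 < w q`_i)%E.
Proof.
elim: rs q => [|a rs IH] q /= q_size rs_ge0 q_rs.
  move=> _ i; move: q_size; rewrite leqn0 size_poly_eq0 => /eqP->.
  by rewrite coef0 (val0 w_val) ltry.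
move=> /andP[/allP a_rs rs_pw].
have [q1 q1E] : exists q1, q - (q.[a])%:P = q1 * ('X - a%:P).
  by apply/factor_theorem; rewrite /root !hornerE subrr.
have qE : q = q1 * ('X - a%:P) + (q.[a])%:P by rewrite -q1E subrK.
have q1_size : (size q1 <= size rs)%N.
  have [->|q1_neq0] := eqVneq q1 0; first by rewrite size_poly0.
  rewrite -ltnS; apply: leq_trans q_size.
  have size_mul_root : size (q1 * ('X - a%:P)) = (size q1).+1.
    by rewrite size_Mmonic ?monicXsubC // size_XsubC addn2.
  rewrite qE size_polyDl size_mul_root // size_polyC.
  by apply: (@leq_ltn_trans 1); [exact: leq_b1|rewrite ltnS size_poly_gt0].
have q1_rs b : b \in rs -> (0 < w q1.[b])%E.
  move=> brs; have : w (q1.[b] * (b - a)) = w q1.[b].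
    by rewrite (valM w_val) (valBC w_val) (eqP (a_rs _ brs)) adde0.
  have -> : q1.[b] * (b - a) = q.[b] - q.[a] by rewrite {1}qE !hornerE addrK.
  move=> <-; apply: (val_gtD w_val); rewrite ?(valN w_val); apply: q_rs.
    by rewrite inE brs orbT.
  by rewrite inE eqxx.
have a_in : a \in a :: rs by rewrite mem_head.
have {}IH := IH q1 q1_size _ q1_rs rs_pw.
have {}IH i : (0 < w q1`_i)%E.
  by apply: IH => b brs; apply: rs_ge0; rewrite inE brs orbT.
move=> i; rewrite qE coefD coefC mulrBr coefB coefMX coefMC.
apply: (val_gtD w_val).
  apply: (val_gtD w_val); first by case: ifP; rewrite ?(val0 w_val) ?ltry.
  rewrite (valN w_val) (valM w_val); apply: lt_le_trans (IH i) _.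
  by rewrite leeDl // rs_ge0.
by case: ifP => _; rewrite ?(val0 w_val) ?ltry // q_rs.
Qed.

(** Modulo [p], raising to the power [p] is additive and fixes the coefficients of [q] by Fermat's
    congruence. *)
Lemma val_horner_frobenius (q : {poly Qp}) (y : L) :
  (0 <= w y)%E -> (forall i, (0 <= vp q`_i)%E) ->
  (1 <= w ((map_poly iota q).[y] ^+ p - (map_poly iota q).[y ^+ p])%R)%E.
Proof.
move=> y0; elim/poly_ind: q => [|q c IH] q0.
  by rewrite map_poly0 !horner0 expr0n gtn_eqF ?prime_gt0 // subrr (val0 w_val) leey.
have c0 : (0 <= vp c)%E by have := q0 0%N; rewrite -cons_poly_def coef_cons.
have {}q0 i : (0 <= vp q`_i)%E by have := q0 i.+1; rewrite -cons_poly_def coef_cons.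
have qy0 z : (0 <= w z -> 0 <= w (map_poly iota q).[z])%E.
  move=> z0; rewrite horner_coef; apply: (val_ge_sum w_val) => i _.
  by rewrite coef_map (valM_ge0 w_val) ?(valX_ge0 w_val) // w_ext.
rewrite rmorphD rmorphM /= map_polyX map_polyC /= !hornerE.
set a := (map_poly iota q).[y]; set b := (map_poly iota q).[y ^+ p].
have -> : (a * y + iota c) ^+ p - (b * y ^+ p + iota c) =
   ((a * y + iota c) ^+ p - (a * y) ^+ p - iota c ^+ p)
   + ((a ^+ p - b) * y ^+ p + (iota c ^+ p - iota c)) by rewrite exprMn; ring.
have ay0 : (0 <= w (a * y))%E by rewrite (valM_ge0 w_val) // qy0.
have wc0 : (0 <= w (iota c))%E by rewrite w_ext.
apply: (val_geD w_val).
  have := val_frobenius w_val p_prime wp1 1 ay0 wc0; rewrite expn1; apply: le_trans.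
  by rewrite -addeA leeDl // adde_ge0.
apply: (val_geD w_val).
  by rewrite (valM w_val); apply: (le_trans (IH q0)); rewrite leeDl // (valX_ge0 w_val).
by rewrite -rmorphXn -rmorphB w_ext (padic_fermat p_prime Qp_padic p_odd).
Qed.

(** Divide by a coefficient of least valuation. *)
Lemma padic_primitive_scaling (q : {poly Qp}) : q != 0 ->
  exists2 c : Qp, c != 0 & (forall i, (0 <= vp (c *: q)`_i)%E)
                       /\ exists i, vp (c *: q)`_i = 0%E.
Proof.
move=> q0; have q_gt0 : (0 < size q)%N by rewrite size_poly_gt0.
have lt_q : ((size q).-1 < size q)%N by rewrite prednK.
pose i0 := [arg min_(i < Ordinal lt_q) vp q`_i]%O.
have i0_min (i : 'I_(size q)) : (vp q`_i0 <= vp q`_i)%E.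
  by rewrite /i0; case: Order.TotalTheory.arg_minP => // k _ /(_ i isT).
have qi0 : q`_i0 != 0.
  apply: contraTneq (i0_min (Ordinal lt_q)) => ->; rewrite (val0 v_val) leye_eq.
  rewrite (val_finE v_val) //=.
  by rewrite -lead_coefE lead_coef_eq0.
exists (q`_i0)^-1; first by rewrite invr_eq0.
split=> [i|]; last by exists i0; rewrite coefZ mulVf // (val1 v_val).
rewrite coefZ; have [iq|iq] := ltnP i (size q); last first.
  by rewrite (nth_default 0 iq) mulr0 (val0 v_val) leey.
rewrite (valM v_val) (valV v_val) // addeC sube_ge0 ?(i0_min (Ordinal iq)) //.
by rewrite (val_fin v_val).
Qed.

(** With [d] the degree of [F], the [d + 1] conjugates [y k] would be distinct roots, modulo the
    maximal ideal, of a primitive polynomial of size at most [d + 1]; then all its coefficients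
    would reduce to 0, though one is a unit. *)
Lemma roots_of_unity2_in_finite_ext (F : fieldExtType Qp) (j : {rmorphism F -> L})
    (m : nat) (z : F) : is_Kembedding iota j ->
  (2 ^ m).-primitive_root (j z) -> (2 ^ m <= p ^ \dim {:F})%N.
Proof.
move=> jK jz_prim; rewrite leqNgt; apply/negP => lt_pd.
have [q0 [q0_neq0 q0_size q0z]] := finite_ext_annihilator z.
have [c c_neq0 [q_int [i qi]]] := padic_primitive_scaling q0_neq0.
set q := c *: q0 in q_int qi.
have q_size : (size q <= (\dim {:F}).+1)%N by rewrite size_scale.
pose y k := j z ^+ (p ^ k).
have y1 k : y k ^+ (2 ^ m) = 1 by rewrite /y exprAC (prim_expr_order jz_prim) expr1n.
have y0 k : (0 <= w (y k))%E.
  by rewrite (val_root1 w_val (n := 2 ^ m)) // expn_gt0.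
have qy k : (0 < w (map_poly iota q).[y k])%E.
  elim: k => [|k IH].
    rewrite /y expn0 expr1 -(horner_Kembedding _ _ jK) map_polyZ hornerZ.
    by rewrite (eqP q0z) mulr0 rmorph0 (val0 w_val) ltry.
  rewrite /y expnSr exprM -/(y k).
  set a := (map_poly iota q).[y k ^+ p].
  have -> : a = (map_poly iota q).[y k] ^+ p - ((map_poly iota q).[y k] ^+ p - a).
    by rewrite subKr.
  apply: (val_gtD w_val); rewrite ?(valN w_val).
    by rewrite (valX w_val) mule_gt0 // lte_fin ltr0n prime_gt0.
  by apply: lt_le_trans (val_horner_frobenius (y0 k) q_int); rewrite lte_fin.
(* The exponents [p ^ k <= p ^ d] are smaller than the order [2 ^ m], so the powers differ, and they
   still differ after reduction. *)
have y_distinct k l : (k <= \dim {:F})%N -> (l <= \dim {:F})%N -> k != l ->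
    w (y k - y l) = 0%E.
  move=> kd ld kl; apply/eqP; rewrite eq_le (val_geB w_val) // andbT leNgt.
  apply: contra kl => /(val_sub_roots_of_unity2 w_val p_prime wp1 p_odd (y1 k) (y1 l)).
  have lt2 h : (h <= \dim {:F})%N -> (p ^ h < 2 ^ m)%N.
    by move=> hd; apply: leq_ltn_trans lt_pd; rewrite leq_exp2l ?prime_gt1.
  move/eqP; rewrite (eq_prim_root_expr jz_prim) !modn_small ?lt2 //.
  by rewrite eqn_exp2l ?prime_gt1.
have : (0 < w (map_poly iota q)`_i)%E.
  apply: (@val_gt0_of_roots _ [seq y k | k <- seq.iota 0 (\dim {:F}).+1]).
  - by rewrite size_map_poly size_map size_iota.
  - by move=> _ /mapP[k _ ->].
  - by move=> _ /mapP[k _ ->].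
  - rewrite pairwise_map; apply/(pairwiseP 0%N) => k l.
    rewrite !inE size_iota => kd ld kl; rewrite !nth_iota // !add0n /=.
    by rewrite y_distinct ?ltn_eqF.
by rewrite coef_map w_ext qi ltxx.
Qed.

(** The simple extension generated by [x] contains all powers of [x], so it splits ['X^n - 1], which
    is separable in characteristic 0. *)
Lemma splitting_field_root_of_unity (n : nat) (x : L) : n.-primitive_root x ->
  exists (F : splittingFieldType Qp) (j : {rmorphism F -> L}) (z : F),
    [/\ is_Kembedding iota j, galois 1 {:F} & j z = x].
Proof.
move=> x_prim; have [F [j [z [jK jz gen]]]] := simple_extension (iota_closure x).
have z_prim : n.-primitive_root z by rewrite -(fmorph_primitive_root j) jz.
have Xn_over : ('X^n - 1 : {poly F}) \is a polyOver 1%AS.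
  by rewrite rpredB ?rpred1 ?polyOverXn.
have Xn_split : splittingFieldFor 1 ('X^n - 1) {:F}.
  exists [seq z ^+ i | i <- index_iota 0 n].
    by rewrite big_map factor_Xn_sub_1 // eqpxx.
  apply/vspaceP => y; rewrite memvf; have [q ->] := gen y.
  apply: rpred_horner; last first.
    (* The index [1 %% n] also covers [n = 1], where the list stops at the exponent 0. *)
    apply: seqv_sub_adjoin; apply/mapP; exists (1 %% n)%N.
      by rewrite mem_index_iota ltn_pmod // (prim_order_gt0 x_prim).
    by rewrite (prim_expr_mod z_prim) expr1.
  by apply/polyOverP => i; rewrite coef_map rpredZ // rpred1.
have F_split : SplittingField.axiom F by exists ('X^n - 1).
pose F' : splittingFieldType Qp := HB.pack F
  (FieldExt_isSplittingField.Build Qp F F_split).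
exists F', j, z; split => //.
apply/splitting_galoisField; exists ('X^n - 1); split => //.
apply: separable_Xn_sub_1; rewrite -(fmorph_eq0 j) rmorph_nat.
apply: (char0_of_val w_val p_prime wp1); exact: prim_order_gt0 x_prim.
Qed.

(** Inertia acts trivially modulo the maximal ideal, where roots of unity of 2-power order remain
    distinct. *)
Lemma inertia_fixes_roots_of_unity2 (s : L -> L) (m : nat) (x : L) :
  abs_upper_ramification w iota 0 s -> (2 ^ m).-primitive_root x -> s x = x.
Proof.
move=> [_ s_up] x_prim.
have [F [j [z [jK F_gal jz]]]] := splitting_field_root_of_unity x_prim.
have [g [e [t [[e_gt0 _] t_ge herb]]]] := s_up F j jK F_gal.
rewrite inE => /andP[_ /asboolP g_t] gs.
(* Herbrand's function takes the value -1 at -1, so [herbrand w j e t = 0] excludes [t = -1]. *)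
have t_gt : 0 < t + 1.
  rewrite -[1]opprK subr_gt0 lt_neqAle t_ge andbT; apply/eqP => tN1.
  by move: herb; rewrite -tN1 /herbrand oppr_le0 ler01 => /eqP; rewrite oppr_eq0 oner_eq0.
have x1 := prim_expr_order x_prim.
have w_gz : (0 < w (s x - x))%E.
  rewrite -jz -gs -rmorphB; have : val_ring w j z.
    by rewrite /val_ring /= jz (val_root1 w_val _ x1) // expn_gt0.
  move=> /g_t; rewrite !ltNge; apply: contraTN => gz_le0.
  rewrite -ltNge; apply: (@le_lt_trans _ _ 0%E); last by rewrite lte_fin.
  by rewrite mule_ge0_le0 // lee_fin.
apply: (val_sub_roots_of_unity2 w_val p_prime wp1 p_odd _ x1 w_gz).
have z1 : z ^+ (2 ^ m) = 1 by apply: (fmorph_inj j); rewrite rmorphXn jz x1 rmorph1.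
by rewrite -jz -gs -!rmorphXn /= z1 !rmorph1.
Qed.

(** The identity is the point at which openness will be tested; membership requires a normalizing
    factor for each finite Galois extension. *)
Lemma id_in_abs_inertia : abs_upper_ramification w iota 0 id.
Proof.
split.
  by split => //; exists id.
move=> F j jK _; exists 1%g; last by move=> x; rewrite gal_id.
have [e e_norm] := normalizing_factor_exists jK.
exists e, 0; split => //.
  by rewrite /herbrand lexx.
rewrite inE group1; apply/asboolP => x _.
rewrite gal_id subrr rmorph0 (val0 w_val) gt0_muley ?leey //.
by rewrite lte_fin ltr0n; case: e_norm.
Qed.

End FiniteExtension.

(** * Failure of the APF property *)

Section NotAPF.
Variables (R : realType) (p : nat) (Qp : fieldType) (vp : Qp -> \bar R).
Hypotheses (p_prime : prime p) (p_odd : odd p) (Qp_padic : is_padic_field p vp).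
Variables (L : closedFieldType) (iota : {rmorphism Qp -> L}).
Hypothesis iota_closure : is_algebraic_closure iota.
Variable w : L -> \bar R.
Hypotheses (w_val : is_valuation w) (w_ext : forall a, w (iota a) = vp a).

Lemma not_apf_of_roots_of_unity2 (M : set L) :
  (forall m, exists2 x, M x & (2 ^ m.+1).-primitive_root x) ->
  ~ arithmetically_profinite w iota M.
Proof.
(* The definition is contradicted at [u = 0], for the inertia group. *)
move=> M_roots /(_ 0); rewrite lerN10 => /(_ isT)[_ H_open].
have wp1 : w p%:R = 1%E := ext_valp Qp_padic w_ext.
have [|F [j [jK jF]]] := H_open id.
  exists id; first exact: (id_in_abs_inertia p_prime Qp_padic w_val w_ext).
  by exists id => //; split => //; split => //; exists id.
(* This [m] satisfies [p ^ d < 2 ^ m.+1], so a root of unity of order [2 ^ m.+1] lies outside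
   [F]. *)
pose m := (p ^ \dim {:F})%N.
have [x Mx x_prim] := M_roots m.
have x_out : ~ range j x.
  move=> [z _ jz]; rewrite -jz in x_prim.
  have := roots_of_unity2_in_finite_ext p_prime p_odd Qp_padic w_val w_ext jK x_prim.
  by rewrite leqNgt (ltn_trans (ltnSn m)) // ltn_expl.
have char0 := char0_of_val w_val p_prime wp1.
have [s s_gal [sj sx]] := galois_moves_outside iota_closure jK char0 x_out.
(* As [s] fixes [F], it is a product [a \o b] of an inertia element and an automorphism fixing [M];
   both fix [x], but [s] moves it. *)
have [a a_in [b [_ b_fix] abE]] := jF s s_gal sj.
apply: sx; rewrite -abE /= b_fix //.
exact: (inertia_fixes_roots_of_unity2 p_prime p_odd Qp_padic iota_closure w_val w_ext a_in x_prim).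
Qed.

End NotAPF.

(** * The trace in an arbitrary basis, and the traces of powers of a radical *)

Section Trace.
Variables (K : fieldType) (F : fieldExtType K).

(** Inserting the identity between the two bases factors the matrix of multiplication;
    [mxtrace_mulC] then exchanges the bases. *)
Lemma field_trace_basis n (e : n.-tuple F) (x : F) : basis_of {:F} e ->
  field_trace x = \sum_i coord e i (e`_i * x).
Proof.
move=> e_basis; have vb_basis : basis_of {:F} (vbasis {:F}) := vbasisP _.
have nE : n = \dim {:F} by rewrite -(size_basis e_basis).
subst n; have idE : amulr x = (amulr x \o \1)%VF by rewrite comp_lfun1r.
rewrite /field_trace [in LHS]idE (passmx.mxof_comp _ _ e_basis).
rewrite mxtrace_mulC -(passmx.mxof_comp _ _ vb_basis) comp_lfun1l /mxtrace.
apply: eq_bigr => i _; rewrite !mxE /=.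
by rewrite passmx.vecof_delta lfunE.
Qed.

Lemma field_trace_scalar : scalar (@field_trace K F).
Proof.
move=> a x y; have e_basis : basis_of {:F} (vbasis {:F}) := vbasisP _.
rewrite !(field_trace_basis _ e_basis) mulr_sumr -big_split /=.
by apply: eq_bigr => i _; rewrite mulrDr -scalerAr linearP.
Qed.

HB.instance Definition _ := GRing.isLinear.Build K F K *%R (@field_trace K F) field_trace_scalar.

(** Multiplication by [z ^+ l] sends [z ^+ i] to a multiple of [z ^+ ((i + l) %% N)], so diagonal
    entries vanish unless [N] divides [l], when each is [s ^+ (l %/ N)]. *)
Lemma field_trace_root (N : nat) (z : F) (s : K) (l : nat) : (0 < N)%N ->
  z ^+ N = s%:A -> basis_of {:F} [seq z ^+ i | i <- seq.iota 0 N] ->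
  field_trace (z ^+ l) = if (N %| l)%N then N%:R * s ^+ (l %/ N) else 0.
Proof.
move=> N_gt0 zN e_basis.
pose e := [tuple z ^+ i | i < N].
have eE : e = [seq z ^+ i | i <- seq.iota 0 N] :> seq F.
  by rewrite /= -val_enum_ord -map_comp.
have e_nth (i : 'I_N) : e`_i = z ^+ i by rewrite -tnth_nth tnth_mktuple.
have {}e_basis : basis_of {:F} e by rewrite eE.
have e_free := basis_free e_basis.
rewrite (field_trace_basis _ e_basis).
have term (i : 'I_N) : coord e i (e`_i * z ^+ l) =
    if (N %| l)%N then s ^+ (l %/ N) else 0.
  pose k := Ordinal (ltn_pmod (i + l) N_gt0).
  have zE : z ^+ (i + l) = s ^+ ((i + l) %/ N) *: z ^+ k.
    rewrite {1}(divn_eq (i + l) N) exprD mulnC exprM zN.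
    by rewrite exprZn expr1n -scalerAl mul1r.
  rewrite e_nth -exprD zE linearZ /= -(e_nth k) coord_free //.
  have -> : (k == i) = (N %| l)%N.
    rewrite -val_eqE /= -[X in _ == X](modn_small (ltn_ord i)).
    by rewrite -[X in _ == X %[mod _]]addn0 eqn_modDl mod0n.
  case: ifP => [/dvdnP[c ->]|_]; last by rewrite mulr0.
  by rewrite mulr1 addnC divnMDl // divn_small // addn0 mulnK.
rewrite (eq_bigr _ (fun i _ => term i)) sumr_const card_ord.
by case: ifP => _; rewrite ?mul0rn // mulr_natl.
Qed.

End Trace.

(** * The different of the extension generated by a root of X^N = 1 + p *)

Section KummerExtension.
Variables (R : realType) (p : nat) (Qp : fieldType) (vp : Qp -> \bar R).
Hypotheses (p_prime : prime p) (Qp_padic : is_padic_field p vp).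
Variables (L : closedFieldType) (iota : {rmorphism Qp -> L}).
Variable w : L -> \bar R.
Hypotheses (w_val : is_valuation w) (w_ext : forall a, w (iota a) = vp a).

Let v_val := padic_val Qp_padic.
Let wp1 := ext_valp Qp_padic w_ext.

(** With [y = u - 1], the Frobenius congruence shows that [y ^+ (p ^ n)] is [p] up to an error of
    valuation at least [1 + w y]. Once [w y > 0] is known, the power has valuation exactly 1. *)
Lemma val_kummer_uniformizer n (u : L) : u ^+ (p ^ n) = 1 + p%:R ->
  w (u - 1) = ((p ^ n)%:R^-1)%:E.
Proof.
move=> uN; have N_gt0 : (0 < p ^ n)%N by rewrite expn_gt0 prime_gt0.
have wu : w u = 0%E.
  apply: (valX_eq0 w_val N_gt0); rewrite uN.
  by apply: (val_principal_unit w_val); rewrite addrAC subrr add0r wp1.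
set y := u - 1; have wy0 : (0 <= w y)%E by rewrite (val_geB w_val) ?wu ?(val1 w_val).
have := val_frobenius1 w_val p_prime wp1 n wy0.
rewrite /y [1 + (u - 1)]addrC subrK -/y uN [1 + p%:R]addrC addrK => w_diff.
have wyN : w (y ^+ (p ^ n)) = ((p ^ n)%:R%:E * w y)%E by rewrite (valX w_val).
have yNE : y ^+ (p ^ n) = p%:R - (p%:R - y ^+ (p ^ n)) by rewrite subKr.
have wy_gt0 : (0 < w y)%E.
  rewrite ltNge; apply/negP => wy_le0.
  have : (1 <= w (y ^+ (p ^ n)))%E.
    rewrite yNE (val_geB w_val) ?wp1 //; apply: le_trans w_diff.
    by rewrite leeDl.
  have -> : w (y ^+ (p ^ n)) = 0%E.
    have wy : w y = 0%E by apply/eqP; rewrite eq_le wy_le0.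
    by rewrite wyN wy mule0.
  by rewrite lee_fin ler10.
have y0 : y != 0.
  apply/eqP => y0; move: w_diff; rewrite y0 expr0n gtn_eqF // subr0 wp1.
  by rewrite (val0 w_val) addey // leye_eq.
have : w (y ^+ (p ^ n)) = 1%E.
  rewrite yNE (valD_lt w_val) wp1 // (valN w_val).
  apply: lt_le_trans w_diff; rewrite (val_finE w_val y0) -EFinD lte_fin ltrDl.
  by rewrite -lte_fin -(val_finE w_val y0).
rewrite wyN (val_finE w_val y0) -EFinM => -[h].
have N0 : (p ^ n)%:R != 0 :> R by rewrite pnatr_eq0 -lt0n.
by congr EFin; apply: (mulfI N0); rewrite h divff.
Qed.

Variables (n : nat) (F : fieldExtType Qp) (j : {rmorphism F -> L}) (z : F).
Hypotheses (jK : is_Kembedding iota j)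
  (z_gen : forall y : F, exists q : {poly Qp}, y = (map_poly (in_alg F) q).[z])
  (zN : z ^+ (p ^ n) = 1 + p%:R).

Let N := (p ^ n)%N.
Let N_gt0 : (0 < N)%N. Proof. by rewrite expn_gt0 prime_gt0. Qed.
Let s : Qp := 1 + p%:R.

Let evalz (q : {poly Qp}) : F := (map_poly (in_alg F) q).[z].

Let zNs : z ^+ N = s%:A.
Proof. by rewrite zN -[RHS]/(in_alg F s) rmorphD rmorph1 rmorph_nat. Qed.

Let vs : vp s = 0%E.
Proof.
apply: (val_principal_unit v_val).
by rewrite /s addrAC subrr add0r (padic_valp Qp_padic).
Qed.

Let wz : w (j z) = 0%E.
Proof.
apply: (@valX_eq0 _ _ _ w_val _ N N_gt0); rewrite -rmorphXn zNs jK.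
by rewrite w_ext vs.
Qed.

(** Take the remainder modulo ['X^N - s%:P], which vanishes at [z]. *)
Lemma kummer_reduced y : exists2 q : {poly Qp}, (size q <= N)%N & y = evalz q.
Proof.
have [q ->] := z_gen y; pose m : {poly Qp} := 'X^N - s%:P.
have m_size : size m = N.+1 by rewrite size_XnsubC.
exists (q %% m).
  by rewrite -ltnS -m_size ltn_modp -size_poly_eq0 m_size.
rewrite /evalz {1}(divp_eq q m) rmorphD rmorphM /= !hornerE rmorphB /= map_polyXn.
by rewrite map_polyC /= !hornerE zNs subrr mulr0 add0r.
Qed.

(* The powers of the uniformizer z - 1 have distinct valuations modulo Z. *)
Lemma kummer_val_coef (r : {poly Qp}) : (size r <= N)%N -> forall i : nat,
  (w (j (map_poly (in_alg F) r).[z - 1]) <= vp r`_i + (i%:R / N%:R)%:E)%E.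
Proof.
move=> r_size i; have [ri|ri] := ltnP i (size r); last first.
  by rewrite (nth_default 0 ri) (val0 v_val) addye ?leey.
have jzN : j z ^+ (p ^ n) = 1 + p%:R by rewrite -rmorphXn zN rmorphD rmorph1 rmorph_nat.
have wpi := val_kummer_uniformizer jzN.
have pi_neq0 : j z - 1 != 0.
  by apply: contra_eq_neq wpi => ->; rewrite (val0 w_val).
pose T (k : 'I_(size r)) := iota r`_k * (j z - 1) ^+ k.
have TE k : T k != 0 -> exists a : int, w (T k) = (a%:~R + k%:R / N%:R)%:E.
  rewrite mulf_eq0 negb_or fmorph_eq0 => /andP[rk0 _].
  have [a ra] := padic_val_int p_prime Qp_padic rk0; exists a.
  by rewrite (valM w_val) (valX w_val) w_ext ra wpi.
have -> : j (map_poly (in_alg F) r).[z - 1] = \sum_k T k.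
  rewrite (horner_Kembedding _ _ jK) horner_coef size_map_poly rmorphB rmorph1.
  by apply: eq_bigr => k _; rewrite coef_map.
have -> : (vp r`_i + (i%:R / N%:R)%:E)%E = w (T (Ordinal ri)).
  by rewrite (valM w_val) (valX w_val) w_ext wpi.
apply: (val_sum_distinct w_val) => k l kl /TE[a ->] /TE[b ->].
apply: contra_neq kl => -[/eqP].
have N_neq0 : N%:R != 0 :> R by rewrite pnatr_eq0 -lt0n.
rewrite -(inj_eq (mulIf N_neq0)) !mulrDl !divfK // => /eqP abkl.
(* Clearing denominators gives an equality of integers; as [k] and [l] are below [N], reduction
   modulo [N] identifies them. *)
have {}abkl : (a * N%:Z + k%:Z = b * N%:Z + l%:Z)%R.
  by apply/eqP; rewrite -(eqr_int R) !rmorphD !rmorphM /= -!pmulrn abkl.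
apply/val_inj => /=; apply/eqP; rewrite -eqz_nat.
have small (h : 'I_(size r)) : (h%:Z %% N)%Z = h.
  by rewrite modz_nat modn_small // (leq_trans (ltn_ord h)).
have := congr1 (fun x => (x %% N)%Z) abkl.
by rewrite !modzMDl !small => ->.
Qed.

Let int_coefs (q : {poly Qp}) := forall i, (0 <= vp q`_i)%E.

Let int_coefs_comp q r : int_coefs q -> int_coefs r -> int_coefs (q \Po r).
Proof.
pose O : {pred Qp} := fun x => `[< (0 <= vp x)%E >].
have O_subring : subring_closed O.
  split; first by apply/asboolP; rewrite (val1 v_val).
    by move=> x y /asboolP x0 /asboolP y0; apply/asboolP; exact: (val_geB v_val).
  by move=> x y /asboolP x0 /asboolP y0; apply/asboolP; exact: (valM_ge0 v_val).
pose Oc : subringClosed Qp := HB.pack O (GRing.isSubringClosed.Build Qp O O_subring).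
have overP t : reflect (int_coefs t) (t \is a polyOver Oc).
  by apply: (iffP polyOverP) => t0 i; have := t0 i; [move/asboolP|move=> ?; apply/asboolP].
by move=> /overP q0 /overP r0; apply/overP; rewrite polyOver_comp.
Qed.

Let size_shift (q : {poly Qp}) c : size (q \Po ('X + c%:P)) = size q.
Proof. by rewrite size_comp_poly2 // size_XaddC. Qed.

Let evalz_shift q : evalz q = (map_poly (in_alg F) (q \Po ('X + 1%:P))).[z - 1].
Proof.
rewrite map_comp_poly horner_comp rmorphD /= map_polyX map_polyC /= !hornerE.
by rewrite scale1r subrK.
Qed.

(** In powers of [z - 1], each nonzero coefficient has an integral valuation at least
    [- i / N > -1], hence nonnegative; the shift back to powers of [z] is integral. With the
    converse below, the powers of [z] span the ring of integers. *)
Lemma kummer_integral_coefs (q : {poly Qp}) : (size q <= N)%N ->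
  (0 <= w (j (evalz q)))%E -> int_coefs q.
Proof.
move=> q_size qz; set r := q \Po ('X + 1%:P).
have qE : q = r \Po ('X + (-1)%:P).
  rewrite /r -comp_polyA comp_polyD comp_polyX comp_polyC -addrA -polyCD addNr.
  by rewrite addr0 comp_polyXr.
rewrite qE; apply: int_coefs_comp => i.
  have [->|ri0] := eqVneq r`_i 0; first by rewrite (val0 v_val) leey.
  have [ri|ri] := ltnP i (size r); last by rewrite nth_default // (val0 v_val) leey.
  have r_size : (size r <= N)%N by rewrite size_shift.
  have := kummer_val_coef r_size i; rewrite -evalz_shift => /(le_trans qz).
  have [a ra] := padic_val_int p_prime Qp_padic ri0; rewrite ra -EFinD !lee_fin.
  move=> a_ge; rewrite ler0z -ltzD1 -(ltr_int R) rmorphD /=; apply: le_lt_trans a_ge _.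
  rewrite ltrD2l ltr_pdivrMr ?ltr0n // mul1r ltr_nat; exact: leq_trans r_size.
rewrite coefD coefX coefC (val_geD v_val) ?(val_nat_ge0 v_val) //.
by case: ifP => _; rewrite ?(valN v_val) ?(val1 v_val) ?(val0 v_val) ?leey.
Qed.

Lemma kummer_integral (q : {poly Qp}) : int_coefs q -> (0 <= w (j (evalz q)))%E.
Proof.
move=> q0; rewrite /evalz (horner_Kembedding _ _ jK) horner_coef.
apply: (val_ge_sum w_val) => i _; rewrite coef_map (valM_ge0 w_val) //.
  by rewrite w_ext q0.
by rewrite (valX w_val) wz mule0.
Qed.

(** Reduction gives spanning. A relation [q(z) = 0] has infinite valuation, so the valuation bound
    makes every coefficient in powers of [z - 1] zero. *)
Lemma kummer_basis : basis_of {:F} [seq z ^+ i | i <- seq.iota 0 N].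
Proof.
pose e := [tuple z ^+ i | i < N].
have eE : [seq z ^+ i | i <- seq.iota 0 N] = e :> seq F.
  by rewrite /= -val_enum_ord -map_comp.
rewrite eE; have e_nth (i : 'I_N) : e`_i = z ^+ i by rewrite -tnth_nth tnth_mktuple.
have evalz_sum (q : {poly Qp}) : (size q <= N)%N -> evalz q = \sum_(i < N) q`_i *: e`_i.
  move=> q_size; rewrite /evalz (horner_coef_wide _ (n := N)) ?size_map_poly //.
  by apply: eq_bigr => i _; rewrite coef_map e_nth mulr_algl.
rewrite basisEfree subvf size_tuple; apply/and3P; split => //; last first.
  have -> : {:F}%VS = <<e>>%VS; last by rewrite -[X in (_ <= X)%N](size_tuple e) dim_span.
  apply/vspaceP => y; rewrite memvf; have [q q_size ->] := kummer_reduced y.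
  rewrite evalz_sum // memv_suml // => i _; rewrite memvZ // memv_span //.
  by rewrite mem_nth // size_tuple.
apply/freeP => c c0 i; pose q := \poly_(k < N) (if insub k is Some h then c h else 0).
have qi (k : 'I_N) : q`_k = c k by rewrite coef_poly ltn_ord valK.
have q_size : (size q <= N)%N by exact: size_poly.
have qz : evalz q = 0.
  by rewrite evalz_sum // -[RHS]c0; apply: eq_bigr => k _; rewrite qi.
pose r := q \Po ('X + 1%:P).
have r0 : r = 0.
  apply/polyP => k; rewrite coef0; apply/eqP/negPn/negP => rk.
  have := @kummer_val_coef r; rewrite size_shift => /(_ q_size k).
  rewrite -evalz_shift qz rmorph0 (val0 w_val) (val_finE v_val rk) -EFinD.
  by rewrite leye_eq.
have q0 : q = 0.
  by apply/eqP; rewrite -size_poly_eq0 -(size_shift q 1) -/r r0 size_poly0.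
by rewrite -qi q0 coef0.
Qed.

Lemma kummer_trace (l : nat) :
  field_trace (z ^+ l) = if (N %| l)%N then N%:R * s ^+ (l %/ N) else 0.
Proof. exact: (field_trace_root l N_gt0 zNs kummer_basis). Qed.

Let trace_sum (q : {poly Qp}) (k : nat) : (size q <= N)%N ->
  field_trace (evalz q * z ^+ k) = \sum_(i < N) q`_i * field_trace (z ^+ (i + k)).
Proof.
move=> q_size; rewrite /evalz (horner_coef_wide _ (n := N)) ?size_map_poly //.
rewrite mulr_suml raddf_sum /=; apply: eq_bigr => i _.
by rewrite coef_map mulr_algl -scalerAl -exprD linearZ.
Qed.

(** If [N x] and [y] are integral, the trace of [N x y] is [N] times its constant coefficient, so
    that of [x y] is integral. Conversely, traces of [x z^i] recover the coefficients of [N x] up to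
    the unit [s]. *)
Lemma kummer_codifferent (x : F) :
  codifferent w iota j x <-> val_ring w j (N%:R * x).
Proof.
split=> [x_codiff|Nx y y_int]; last first.
  have [q q_size qE] := kummer_reduced (N%:R * x * y).
  have q0 : int_coefs q.
    apply: kummer_integral_coefs => //.
    by rewrite -qE rmorphM (valM_ge0 w_val).
  have N_unit : N%:R != 0 :> Qp.
    exact: (char0_of_val v_val p_prime (padic_valp Qp_padic)).
  have : N%:R * field_trace (x * y) = N%:R * q`_0.
    have -> : N%:R * field_trace (x * y) = field_trace (N%:R * x * y).
      by rewrite mulr_natl [N%:R * x]mulr_natl mulrnAl raddfMn.
    rewrite qE -[evalz q]mulr1 -[1]/(z ^+ 0) trace_sum //.
    rewrite (bigD1 (Ordinal N_gt0)) //= big1 => [|i i0].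
      by rewrite addr0 addn0 kummer_trace dvdn0 div0n expr0 mulr1 mulrC.
    rewrite addn0 kummer_trace gtnNdvd ?mulr0 // lt0n.
    exact: i0.
  by move/(mulfI N_unit) => ->; rewrite /val_ring /= w_ext.
have [q q_size qE] := kummer_reduced x.
rewrite qE /val_ring /= mulr_natl.
have -> : evalz q *+ N = evalz (q *+ N) by rewrite /evalz rmorphMn /= hornerMn.
apply: kummer_integral => k; rewrite coefMn.
have [kN|kN] := ltnP k N; last first.
  by rewrite (nth_default 0 (leq_trans q_size kN)) mul0rn (val0 v_val) leey.
(* Multiplication by [z ^+ (N - k)] moves the [k]-th term to [z ^+ N], the only power occurring here
   with nonzero trace. *)
have : val_ring w iota (field_trace (x * z ^+ (N - k))).
  by apply: x_codiff; rewrite /val_ring /= rmorphXn (valX w_val) wz mule0.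
rewrite qE trace_sum // (bigD1 (Ordinal kN)) //= big1 => [|i ik].
  rewrite subnKC ?(ltnW kN) // kummer_trace dvdnn divnn N_gt0 expr1 addr0.
  by rewrite /val_ring /= w_ext mulrA (valM v_val) vs adde0 mulr_natr.
rewrite kummer_trace; case: ifP => [|_]; last by rewrite mulr0.
(* 0 < i + (N - k) < 2 N, so N divides it only if i = k. *)
move=> /dvdnP[c cE]; case/eqP: ik; apply/val_inj => /=.
have iN := ltn_ord i; case: c cE => [|[|c]]; rewrite ?mulSn ?mul0n; lia.
Qed.

(** The codifferent is generated by the inverse of [N], so testing an element of the different
    against that inverse suffices. *)
Lemma kummer_different_generator :
  different_generator w iota j (p ^ n)%:R.
Proof.
rewrite -/N; have N_unit : N%:R != 0 :> F.
  by rewrite -(fmorph_eq0 j) rmorph_nat (char0_of_val w_val p_prime wp1).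
apply/seteqP; split => [x x_diff|_ [y y_int <-] x /kummer_codifferent Nx].
  exists (x * N%:R^-1); last by rewrite mulrC divfK.
  apply: x_diff; apply/kummer_codifferent.
  by rewrite divff // /val_ring /= rmorph1 (val1 w_val).
by rewrite /val_ring /= mulrAC mulrC rmorphM (valM_ge0 w_val).
Qed.

End KummerExtension.

(** * Subfields generated by one element *)

Section Adjoin.
Variables (L : fieldType).

Section Subfield.
Variable S : set L.
Hypothesis S_subfield : is_subfield S.

Lemma subfield1 : S 1. Proof. by case: S_subfield. Qed.

Lemma subfieldB x y : S x -> S y -> S (x - y).
Proof. by case: S_subfield => _ + _; exact. Qed.

Lemma subfield_div x y : S x -> S y -> S (x / y).
Proof. by case: S_subfield => _ _; exact. Qed.

Lemma subfield0 : S 0.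
Proof. by rewrite -(subrr 1); apply: subfieldB; exact: subfield1. Qed.

Lemma subfieldD x y : S x -> S y -> S (x + y).
Proof.
move=> Sx Sy; rewrite -[y]opprK -[- y]sub0r.
by apply: subfieldB => //; apply: subfieldB => //; exact: subfield0.
Qed.

Lemma subfieldM x y : S x -> S y -> S (x * y).
Proof.
move=> Sx Sy; rewrite -[y]invrK -[y^-1]div1r.
by apply: subfield_div => //; apply: subfield_div => //; exact: subfield1.
Qed.

Lemma subfieldX x n : S x -> S (x ^+ n).
Proof.
move=> Sx; elim: n => [|n IH]; first exact: subfield1.
by rewrite exprS; exact: subfieldM.
Qed.

End Subfield.

Variables (K : fieldType) (iota : {rmorphism K -> L}).

Lemma adjoin_is_subfield x : is_subfield (adjoin iota x).
Proof.
split.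
- by move=> S [S_sub _]; exact: subfield1.
- by move=> y z xy xz S hS; apply: (subfieldB hS.1); [exact: xy|exact: xz].
- by move=> y z xy xz S hS; apply: (subfield_div hS.1); [exact: xy|exact: xz].
Qed.

Lemma adjoin_gen x : adjoin iota x x.
Proof. by move=> S [_]; apply; right. Qed.

Lemma adjoin_base x a : adjoin iota x (iota a).
Proof. by move=> S [_]; apply; left; exists a. Qed.

Lemma adjoin_horner x y (q : {poly K}) :
  adjoin iota x y -> adjoin iota x (map_poly iota q).[y].
Proof.
have x_sub := adjoin_is_subfield x; move=> xy.
elim/poly_ind: q => [|q c IH].
  by rewrite map_poly0 horner0; exact: (subfield0 x_sub).
rewrite rmorphD rmorphM /= map_polyX map_polyC /= !hornerE.
by apply: (subfieldD x_sub); [exact: (subfieldM x_sub)|exact: adjoin_base].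
Qed.

End Adjoin.

(** * The tower of [2p]-th roots and its roots of unity *)

Lemma primitive_root_pow2 (L : idomainType) (x : L) m :
  x ^+ (2 ^ m) = -1 -> (-1 : L) != 1 -> (2 ^ m.+1).-primitive_root x.
Proof.
move=> xN1 N1; have x1 : x ^+ (2 ^ m.+1) = 1.
  by rewrite expnSr exprM xN1 sqrrN expr1n.
have m_gt0 : (0 < 2 ^ m.+1)%N by rewrite expn_gt0.
have [k k_prim] := prim_order_exists m_gt0 x1.
move=> /(dvdn_pfactor _ _ (isT : prime 2))[e e_le kE].
rewrite kE in k_prim; have [->|e_neq] := eqVneq m.+1 e; first by [].
have e_lt : (e <= m)%N by rewrite -ltnS ltn_neqAle eq_sym e_neq.
have : x ^+ (2 ^ m) = 1.
  by apply/eqP; rewrite -(prim_order_dvd k_prim) dvdn_exp2l.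
by rewrite xN1 => /eqP; rewrite (negPf N1).
Qed.

Lemma closed_field_root (L : closedFieldType) (x : L) n : (0 < n)%N ->
  exists y, y ^+ n = x.
Proof.
move=> n_gt0; have [y] : exists y, root ('X^n - x%:P) y.
  by apply/closed_rootP; rewrite size_XnsubC //; case: n n_gt0.
by rewrite /root !hornerE subr_eq0 => /eqP yn; exists y.
Qed.

(* Along any tower of 2p-th roots t_n of 1 + p, the element t_n^(p^n) / u_n is a
   2^n-th root of unity, where u_n is the 2^n-th root of 1 + p among the
   principal units; only at the first step must a sign be chosen to make it
   primitive for all n. *)
Lemma root_tower (p : nat) (Qp : fieldType) (L : closedFieldType)
    (iota : {rmorphism Qp -> L}) (u : nat -> Qp) :
  odd p -> u 0%N != 0 -> (forall n, u n.+1 ^+ 2 = u n) ->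
  exists t : nat -> L, [/\ t 0%N = iota (u 0%N),
    forall n, t n.+1 ^+ (2 * p) = t n
    & forall n, (t n.+1 ^+ (p ^ n.+1) / iota (u n.+1)) ^+ (2 ^ n) = -1].
Proof.
move=> p_odd u0 uS; have u_neq0 n : u n != 0.
  by elim: n => // n; rewrite -(uS n) expf_eq0.
pose a n (x : L) := x ^+ (p ^ n) / iota (u n).
(* From level 1 on, the value -1 of the [2 ^ m]-th power ensures the exact order [2 ^ m.+1]; level 0
   only has the quotient 1. *)
pose Q n x := if n is m.+1 then a n x ^+ (2 ^ m) = -1 else a 0%N x = 1.
have step n x : Q n x -> exists y, y ^+ (2 * p) = x /\ Q n.+1 y.
  move=> Qx; have [|y yx] := @closed_field_root L x (2 * p).
    by rewrite muln_gt0 (odd_gt0 p_odd).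
  have a2 : a n.+1 y ^+ 2 = a n x.
    rewrite /a expr_div_n -rmorphXn uS -yx -!exprM.
    by congr (_ ^+ _ / _); rewrite expnS; lia.
  case: n Qx a2 => [|m] /= Qx a2; last first.
    by exists y; split => //; rewrite expnS exprM a2.
  have : a 1%N y ^+ 2 == 1 by rewrite a2; apply/eqP.
  rewrite sqrf_eq1 => /orP[/eqP ay|/eqP ay]; last by exists y; rewrite expn0 expr1.
  (* As [p] is odd, passing to [- y] changes the sign of [a 1 y], while the even power [2 * p] is
     unaffected. *)
  exists (- y); split; first by rewrite exprNn exprM sqrrN !expr1n mul1r.
  rewrite /a expn0 expr1 expn1 exprNn -signr_odd p_odd expr1 mulN1r mulNr.
  by congr (- _); move: ay; rewrite /a expn1.
pose T n := {x : L | Q n x}.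
have next n (x : T n) : {y : T n.+1 | sval y ^+ (2 * p) = sval x}.
  apply/cid; case: x => x Qx; have [y [yx Qy]] := step _ _ Qx.
  by exists (exist _ y Qy).
have Q0 : Q 0%N (iota (u 0%N)) by rewrite /Q /a expn0 expr1 divff // fmorph_eq0.
pose t := fix t n : T n :=
  if n is m.+1 return T n then sval (next m (t m)) else exist _ _ Q0.
exists (fun n => sval (t n)); split => // n; last by case: (t n.+1).
by rewrite /=; case: (next n (t n)).
Qed.

Theorem proposition6p1 (R : realType) (p : nat) (p_prime : prime p)
    (p_odd : odd p)
    (Qp : fieldType) (vp : Qp -> \bar R) (Qp_padic : is_padic_field p vp)
    (Qpbar : closedFieldType) (iota : {rmorphism Qp -> Qpbar})
    (Qpbar_closure : is_algebraic_closure iota)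
    (w : Qpbar -> \bar R) (w_valuation : is_valuation w)
    (w_extends : forall a : Qp, w (iota a) = vp a) :
  exists t : nat -> Qpbar,
    [/\ t 0%N = 1 + p%:R,
        forall n : nat, ('X^(2 * p) : {poly Qpbar}).[t n.+1] = t n,
        deeply_ramified w iota (\bigcup_n adjoin iota (t n))
      & ~ arithmetically_profinite w iota (\bigcup_n adjoin iota (t n))].
Proof.
have v_val := padic_val Qp_padic; have vp1 := padic_valp Qp_padic.
have wp1 := ext_valp Qp_padic w_extends.
have s_principal : (1 <= vp (1 + p%:R - 1)%R)%E by rewrite addrC addKr vp1.
have [u [u0 uS u_principal]] :=
  padic_principal_sqrt_chain p_prime Qp_padic p_odd s_principal.
have [|t [t0 tS t_root]] := root_tower iota p_odd _ uS.
  by rewrite u0 (val_eq0_neq0 v_val) // (val_principal_unit v_val).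
rewrite u0 rmorphD rmorph1 rmorph_nat in t0.
exists t; split => //.
- by move=> n; rewrite hornerXn.
(* The different at level [n] has valuation [n], so any [n] above [B] will do. *)
- move=> B; pose n := Num.bound `|B|.
  have t_pow k : t k ^+ ((2 * p) ^ k) = 1 + p%:R.
    elim: k => [|k IH]; first by rewrite expn0 expr1.
    by rewrite expnS exprM tS.
  (* The power removes the 2-part of the exponent [(2 * p) ^ n], leaving a [p ^ n]-th root of
     [1 + p]. *)
  pose x := t n ^+ (2 ^ n).
  have xN : x ^+ (p ^ n) = 1 + p%:R by rewrite -exprM -expnMn t_pow.
  have [F [j [z [jK jz z_gen]]]] := simple_extension (Qpbar_closure x).
  have zN : z ^+ (p ^ n) = 1 + p%:R.
    by apply: (fmorph_inj j); rewrite rmorphXn jz xN rmorphD rmorph1 rmorph_nat.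
  exists F, j, (p ^ n)%:R; split => //.
  + move=> _ [y _ <-]; exists n => //; have [q ->] := z_gen y.
    rewrite (horner_Kembedding _ _ jK) jz; apply: adjoin_horner.
    by apply: (subfieldX (adjoin_is_subfield iota (t n))); exact: adjoin_gen.
  + exact: (kummer_different_generator p_prime Qp_padic w_valuation w_extends jK z_gen zN).
  + rewrite rmorph_nat natrX (valX w_valuation) wp1 mule1 lee_fin.
    exact: le_trans (ler_norm _) (ltW (archi_boundP (normr_ge0 _))).
- apply: (not_apf_of_roots_of_unity2 p_prime p_odd Qp_padic Qpbar_closure
    w_valuation w_extends) => m.
  (* The quotient lies in the field generated by [t m.+1] because [u m.+1] comes from [Qp]. *)
  exists (t m.+1 ^+ (p ^ m.+1) / iota (u m.+1)).
    exists m.+1 => //; have t_sub := adjoin_is_subfield iota (t m.+1).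
    apply: (subfield_div t_sub); last exact: adjoin_base.
    by apply: (subfieldX t_sub); exact: adjoin_gen.
  apply: primitive_root_pow2; first exact: t_root.
  rewrite eq_sym -subr_eq0 opprK.
  exact: (char0_of_val w_valuation p_prime wp1 (n := 2)).
Qed.
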